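(* Let $(F,g)$ be a Riemannian $f$-structure on an $n$-dimensional manifold $M$ and $\nabla$ the Riemannian connection of $g$. Then the canonical connection $\overline\nabla$ and the second fundamental tensor field $h=\nabla-\overline\nabla$ of $(F,g)$ satisfy, for all vector fields $X,Y$ on $M$, $$\overline\nabla_XY=\pi_1\nabla_X\pi_1Y+\tfrac12\pi_2(\nabla_X\pi_2Y-F\nabla_XF\pi_2Y),$$ $$h_XY=\pi_1\nabla_X\pi_2Y+\pi_2\nabla_X\pi_1Y+\tfrac12\pi_2(\nabla_X\pi_2Y+F\nabla_XF\pi_2Y),$$ $$\overline\nabla_XY=\tfrac14(\nabla_XY+S\nabla_XS^3Y+S^2\nabla_XS^2Y+S^3\nabla_XSY).$$
   Context: An $f$-structure is a non-null $(1,1)$ tensor field $F$ with $F^3+F=0$; it is $0$-deformable, of constant rank $2n_2$. Put $\pi_1=F^2+I$, $\pi_2=-F^2$, $L=\pi_1(T(M))$, $V=\pi_2(T(M))$, so $T(M)=L\oplus V$. $g=\langle\,,\rangle$ is an associated Riemannian metric: $V=L^\perp$ and $\langle FX,FY\rangle=\langle X,Y\rangle$ for $X,Y\in V$. $S$ is the $(1,1)$ tensor field with $S=F$ on $V$ and $S=I$ on $L$ (or $S=-I$ on $L$), so $S^4=I$. $P(H)$, $H=O(n-2n_2)\times U(n_2)$, is the subbundle of the orthonormal frame bundle $O(M)$ of frames adapted to $T(M)=L\oplus V$ in which $F$ has matrix $0\oplus\begin{pmatrix}0&E_{n_2}\\-E_{n_2}&0\end{pmatrix}$. Canonical connection: let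 $P(H)\subset O(M)$ be a principal subbundle with group $H\subset O(n)$, $\mathfrak o=\mathfrak o(n)=\mathfrak h\oplus\mathfrak m$ with $\mathfrak h$ the Lie algebra of $H$ and $\mathfrak m=\mathfrak h^\perp$ for the biinvariant Killing form. If $\omega$ is the $\mathfrak o$-valued connection form of the Riemannian connection on $O(M)$, then the $\mathfrak h$-component of $\omega|_{P(H)}$ is a connection form in $P(H)$; the corresponding covariant derivative is the canonical connection $\overline\nabla$, and $h=\nabla-\overline\nabla$ is the second fundamental tensor field. *)

(* Defs.v *)
From HB Require Import structures.
From mathcomp Require Import all_boot all_order all_algebra.
From mathcomp Require Import all_classical all_reals all_analysis.

Set Implicit Arguments.
Unset Strict Implicit.
Unset Printing Implicit Defensive.

Import Order.TTheory GRing.Theory Num.Theory.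
Import numFieldNormedType.Exports.
Local Open Scope classical_set_scope.
Local Open Scope ring_scope.

(* Tangent vectors are columns, so that matrices act on the left. *)

(* [Ck k U f], for U open: all iterated directional derivatives of f of order
   at most k exist on U and are continuous there. *)
Fixpoint Ck (R : realType) (V W : normedModType R) (k : nat) (U : set V)
    (f : V -> W) {struct k} : Prop :=
  (forall x, U x -> {for x, continuous f}) /\
  match k with
  | 0%N => True
  | k'.+1 => forall v : V,
      (forall x, U x -> derivable f x v) /\ Ck k' U (fun x => 'D_v f x)
  end.

Definition smooth_on (R : realType) (V W : normedModType R) (U : set V)
  (f : V -> W) : Prop := forall k, Ck k U f.

(* The tangent space at p is identified with 'cV[R]_n through the chart
   [chart_at p], an arbitrary choice of a chart around each point; all notions
   below that depend on several points transport components between charts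
   by the Jacobian matrices of the chart changes. *)
Record manifold (R : realType) (n : nat) := Manifold {
  carrier :> topologicalType;
  chart : Type;
  dom : chart -> set carrier;
  coord : chart -> carrier -> 'cV[R]_n;
  param : chart -> 'cV[R]_n -> carrier;
  chart_at : carrier -> chart;
  manifold_hausdorff : hausdorff_space carrier;
  manifold_second_countable : @second_countable carrier;
  dom_open : forall c, open (dom c);
  coord_open : forall c, open (coord c @` dom c);
  coordK : forall c p, dom c p -> param c (coord c p) = p;
  coord_continuous : forall c p, dom c p -> {for p, continuous (coord c)};
  param_continuous : forall c p, dom c p ->
    {for coord c p, continuous (param c)};
  chart_atP : forall p, dom (chart_at p) p;
  chart_compatible : forall c d,
    smooth_on (coord c @` (dom c `&` dom d)) (coord d \o param c) }.

Section Tensors.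
Context {R : realType} {n : nat} {M : manifold R n}.

(* Jacobian matrix at q of the change of coordinates from c to d. *)
Definition chart_jacobian (c d : chart M) (q : M) : 'M[R]_n :=
  \matrix_(i < n, j < n)
    ('D_(delta_mx j ord0) (coord d \o param c) (coord c q)) i ord0.

Definition vector_field := M -> 'cV[R]_n.
Definition endo_field := M -> 'M[R]_n.
Definition bilinear_field := M -> 'M[R]_n.

Definition vector_rep (c : chart M) (X : vector_field) (q : M) : 'cV[R]_n :=
  chart_jacobian (chart_at q) c q *m X q.

Definition endo_rep (c : chart M) (F : endo_field) (q : M) : 'M[R]_n :=
  chart_jacobian (chart_at q) c q *m F q *m chart_jacobian c (chart_at q) q.

Definition bilinear_rep (c : chart M) (g : bilinear_field) (q : M) :
    'M[R]_n :=
  (chart_jacobian c (chart_at q) q)^T *m g q *m chart_jacobian c (chart_at q) q.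

Definition smooth_rep (W : normedModType R) (rep : chart M -> M -> W) : Prop :=
  forall c, smooth_on (coord c @` dom c) (rep c \o param c).

Definition smooth_fun (f : M -> R) : Prop :=
  smooth_rep (fun _ => f : M -> R^o).
Definition smooth_vf (X : vector_field) : Prop :=
  smooth_rep (fun c => vector_rep c X).
Definition smooth_endo (F : endo_field) : Prop :=
  smooth_rep (fun c => endo_rep c F).
Definition smooth_bilinear (g : bilinear_field) : Prop :=
  smooth_rep (fun c => bilinear_rep c g).

Definition tensor_app (F : endo_field) (X : vector_field) : vector_field :=
  fun p => F p *m X p.

Definition inner (g : bilinear_field) (p : M) (v w : 'cV[R]_n) : R :=
  (v^T *m g p *m w) ord0 ord0.

Definition fun_deriv (X : vector_field) (f : M -> R) (p : M) : R :=
  'D_(X p) (f \o param (chart_at p) : 'cV[R]_n -> R^o) (coord (chart_at p) p).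

Definition lie_bracket (X Y : vector_field) : vector_field := fun p =>
  let c := chart_at p in
  'D_(X p) (vector_rep c Y \o param c) (coord c p) -
  'D_(Y p) (vector_rep c X \o param c) (coord c p).

Definition riemannian_metric (g : bilinear_field) : Prop :=
  [/\ smooth_bilinear g,
      forall p, (g p)^T = g p &
      forall p (v : 'cV[R]_n), v != 0 -> 0 < inner g p v v].

Definition covariant_derivative := vector_field -> vector_field -> vector_field.

Record affine_connection (nabla : covariant_derivative) : Prop := {
  conn_smooth : forall X Y, smooth_vf X -> smooth_vf Y ->
    smooth_vf (nabla X Y);
  conn_linear : forall f X X' Y, smooth_fun f -> smooth_vf X ->
    smooth_vf X' -> smooth_vf Y -> forall p,
    nabla (fun q => f q *: X q + X' q) Y p =
    f p *: nabla X Y p + nabla X' Y p;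
  conn_additive : forall X Y Y', smooth_vf X -> smooth_vf Y ->
    smooth_vf Y' -> forall p,
    nabla X (fun q => Y q + Y' q) p = nabla X Y p + nabla X Y' p;
  conn_leibniz : forall f X Y, smooth_fun f -> smooth_vf X ->
    smooth_vf Y -> forall p,
    nabla X (fun q => f q *: Y q) p =
    fun_deriv X f p *: Y p + f p *: nabla X Y p }.

Record riemannian_connection (g : bilinear_field)
    (nabla : covariant_derivative) : Prop := {
  rconn_affine : affine_connection nabla;
  rconn_torsion_free : forall X Y, smooth_vf X -> smooth_vf Y -> forall p,
    nabla X Y p - nabla Y X p = lie_bracket X Y p;
  rconn_metric : forall X Y Z, smooth_vf X -> smooth_vf Y ->
    smooth_vf Z -> forall p,
    fun_deriv X (fun q => inner g q (Y q) (Z q)) p =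
    inner g p (nabla X Y p) (Z p) + inner g p (Y p) (nabla X Z p) }.

(* A linear frame at p is an invertible matrix u, read as the isomorphism
   'cV[R]_n -> T_p M; its j-th column is the j-th vector of the frame. *)
Definition frame := (M * 'M[R]_n)%type.

(* Local trivialization of the linear frame bundle over the domain of c. *)
Definition bundle_chart (c : chart M) (z : frame) : 'cV[R]_n * 'M[R]_n :=
  (coord c z.1, chart_jacobian (chart_at z.1) c z.1 *m z.2).

Definition smooth_frame_map (V : normedModType R) (O : set V)
    (phi : V -> frame) : Prop :=
  forall c, let O' := O `&` [set s | dom c (phi s).1] in
    open O' /\ smooth_on O' (bundle_chart c \o phi).

(* Tangent vectors of the frame bundle at z are pairs (v, B), in the
   trivialization given by the chart [chart_at z.1]; v is the projection to the
   tangent space of M. *)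
Definition velocity (V : normedModType R) (phi : V -> frame) (s w : V) :
    'cV[R]_n * 'M[R]_n :=
  'D_w (bundle_chart (chart_at (phi s).1) \o phi) s.

(* Tangent space at z of a subbundle Q of the frame bundle, as the set of
   velocities of the smooth curves in Q through z. *)
Definition tangent (Q : set frame) (z : frame) : set ('cV[R]_n * 'M[R]_n) :=
  [set Z | exists (O : set R^o) (gamma : R^o -> frame),
     [/\ open O /\ O 0, forall t, O t -> Q (gamma t),
         smooth_frame_map O gamma, gamma 0 = z & velocity gamma 0 1 = Z]].

Definition bundle_form := frame -> 'cV[R]_n * 'M[R]_n -> 'M[R]_n.

(* Connection form in a principal bundle Q of linear frames with group H and
   Lie algebra h. The fundamental vector field of A has the value (0, u A) at
   the frame u; smoothness is tested on smooth maps from open sets of R^m. *)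
Record connection_form (Q : set frame) (H h : set 'M[R]_n)
    (omega : bundle_form) : Prop := {
  cform_valued : forall z Z, Q z -> tangent Q z Z -> h (omega z Z);
  cform_linear : forall z (a : R) Z Z', Q z -> tangent Q z Z ->
    tangent Q z Z' -> omega z (a *: Z + Z') = a *: omega z Z + omega z Z';
  cform_vertical : forall z A, Q z -> h A -> omega z (0, z.2 *m A) = A;
  cform_equivariant : forall z a Z, Q z -> H a -> tangent Q z Z ->
    omega (z.1, z.2 *m a) (Z.1, Z.2 *m a) = invmx a *m omega z Z *m a;
  cform_smooth : forall (m : nat) (O : set 'cV[R]_m) (phi : 'cV[R]_m -> frame),
    open O -> (forall s, O s -> Q (phi s)) -> smooth_frame_map O phi ->
    forall w, smooth_on O (fun s => omega (phi s) (velocity phi s w)) }.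

(* The function u |-> u^-1 Y on frames, in the trivialization given by c. *)
Definition frame_components (c : chart M) (Y : vector_field)
    (z : 'cV[R]_n * 'M[R]_n) : 'cV[R]_n :=
  invmx z.2 *m vector_rep c Y (param c z.1).

(* [nabla] is the covariant derivative of the connection form omega in Q:
   u^-1 (nabla_X Y) is the derivative of u |-> u^-1 Y along a horizontal
   lift Z of X to Q. *)
Definition covariant_derivative_of (Q : set frame) (omega : bundle_form)
    (nabla : covariant_derivative) : Prop :=
  forall X Y, smooth_vf X -> smooth_vf Y ->
  forall z Z, Q z -> tangent Q z Z -> omega z Z = 0 -> Z.1 = X z.1 ->
    nabla X Y z.1 =
    z.2 *m 'D_Z (frame_components (chart_at z.1) Y)
                (coord (chart_at z.1) z.1, z.2).

Definition orthonormal_frames (g : bilinear_field) : set frame :=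
  [set z | z.2^T *m g z.1 *m z.2 = 1%:M].

Definition orthogonal_group : set 'M[R]_n := [set a | a^T *m a = 1%:M].
Definition orthogonal_algebra : set 'M[R]_n := [set A | A^T = - A].

(* [A'] is the h-component of A in o(n) = h + m, where m is the orthogonal
   complement of h for the biinvariant form (A, B) |-> - tr (A B); for n > 2 it
   is a positive multiple of minus the Killing form of o(n), which vanishes
   identically for n = 2. *)
Definition h_component (h : set 'M[R]_n) (A A' : 'M[R]_n) : Prop :=
  h A' /\ forall C, h C -> - \tr ((A - A') *m C) = 0.

(* Canonical connection of a principal subbundle P, with Lie algebra h, of the
   orthonormal frame bundle. *)
Definition canonical_connection (g : bilinear_field) (P : set frame)
    (h : set 'M[R]_n) (nabla nablabar : covariant_derivative) : Prop :=
  exists omega omegabar : bundle_form,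
    [/\ connection_form (orthonormal_frames g) orthogonal_group
          orthogonal_algebra omega,
        covariant_derivative_of (orthonormal_frames g) omega nabla,
        forall z Z, P z -> tangent P z Z ->
          h_component h (omega z Z) (omegabar z Z) &
        covariant_derivative_of P omegabar nablabar].

Definition pi1 (F : endo_field) : endo_field := fun p => F p *m F p + 1%:M.
Definition pi2 (F : endo_field) : endo_field := fun p => - (F p *m F p).

Definition distL (F : endo_field) (p : M) : set 'cV[R]_n :=
  range (fun w : 'cV[R]_n => pi1 F p *m w).
Definition distV (F : endo_field) (p : M) : set 'cV[R]_n :=
  range (fun w : 'cV[R]_n => pi2 F p *m w).

Definition f_structure (F : endo_field) (r : nat) : Prop :=
  [/\ smooth_endo F, exists p, F p != 0,
      forall p, F p *m F p *m F p + F p = 0 &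
      forall p, \rank (F p) = r].

Definition riemannian_f_structure (F : endo_field) (g : bilinear_field)
    (r : nat) : Prop :=
  [/\ f_structure F r, riemannian_metric g,
      forall p v, distV F p v <-> (forall l, distL F p l -> inner g p v l = 0) &
      forall p v w, distV F p v -> distV F p w ->
        inner g p (F p *m v) (F p *m w) = inner g p v w].

(* S = F on V and S = eps I on L. *)
Definition s_tensor (eps : R) (F S : endo_field) : Prop :=
  forall p, (forall v, distV F p v -> S p *m v = F p *m v) /\
            (forall v, distL F p v -> S p *m v = eps *: v).

End Tensors.

Arguments vector_field {R n} M.
Arguments endo_field {R n} M.
Arguments bilinear_field {R n} M.
Arguments covariant_derivative {R n} M.
Arguments frame {R n} M.

Notation "F '\app' X" := (tensor_app F X)
  (at level 35, right associativity) : ring_scope.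

(* From here on n = k + 2 n2, where 2 n2 is the rank of F. *)
Section Adapted.
Context {R : realType} {k n2 : nat}.
Notation n := (k + (n2 + n2))%N.

Definition f_matrix : 'M[R]_n :=
  block_mx 0 0 0 (block_mx 0 1%:M (- 1%:M) 0).

(* Block form O(k) x U(n2) or o(k) + u(n2), with a complex matrix
   A + i B realized as the real matrix (A B; -B A), which commutes with
   (0 E; -E 0). *)
Definition h_block (a : 'M[R]_n) : Prop :=
  exists (c : 'M[R]_k) (A B : 'M[R]_n2),
    a = block_mx c 0 0 (block_mx A B (- B) A).

Definition h_algebra : set 'M[R]_n :=
  [set A | orthogonal_algebra A /\ h_block A].

(* The frames of P(H), whose structure group O(k) x U(n2) consists of the
   orthogonal matrices of the form [h_block]. *)
Definition adapted_frames {M : manifold R n} (F : endo_field M)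
    (g : bilinear_field M) : set (frame M) :=
  [set z | [/\ orthonormal_frames g z,
     forall i : 'I_k, distL F z.1 (col (lshift (n2 + n2) i) z.2),
     forall j : 'I_(n2 + n2), distV F z.1 (col (rshift k j) z.2) &
     F z.1 *m z.2 = z.2 *m f_matrix]].

Definition canonical_connection_f {M : manifold R n} (F : endo_field M)
    (g : bilinear_field M) (nabla nablabar : covariant_derivative M) : Prop :=
  canonical_connection g (adapted_frames F g) h_algebra nabla nablabar.

End Adapted.

Definition second_fundamental (R : realType) (n : nat) (M : manifold R n)
    (nabla nablabar : covariant_derivative M) : covariant_derivative M :=
  fun X Y => fun p => nabla X Y p - nablabar X Y p.

(* Main.v *)
(* Along a straight chart line through p with velocity X(p), smooth Gram-Schmidt
   yields a curve of adapted frames.  Correcting it by a curve in the structure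
   group (a Cayley transform) makes its velocity (X(p), B) at the frame z
   horizontal for the canonical connection; then W = omega(X(p), B) lies in m,
   and (X(p), B - z W) is horizontal for the Riemannian connection.  Hence
   nabla_X Y - nablabar_X Y = H Y at p with H = z W z^-1, and differentiating
   F z = z f_matrix along the curve shows that nablabar commutes with F.  That W
   is orthogonal to o(k) + u(n2) means pi1 H pi1 = 0 and pi2 H pi2 = F H F; the
   three formulas follow by algebra. *)

(* Tangency to a frame bundle means being the velocity of an actual smooth curve: the tangent
   vectors at a frame are not known to form a vector space, and a covariant derivative is specified
   only through horizontal tangent vectors. Every vector used, vertical ones and corrected lifts
   included, therefore comes with a curve. A Cayley curve serves because it is orthogonal, rational
   in t, has a prescribed skew velocity at 0, and commutes with whatever its generator commutes
   with, so that it can keep an adapted frame adapted. Both lifts sit at the same frame over the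
   same base velocity. The derivatives of the components of Y then cancel, and what survives is a
   matrix H independent of Y. The definition of the canonical connection states linearity neither of
   [omegabar] nor of [nablabar]. Horizontality of the corrected vector comes instead from
   definiteness of the trace form on skew matrices, and linearity of [nablabar] is read off its
   formula in a chart. Smoothness is phrased with iterated directional derivatives, whereas the
   cocycle rule for Jacobians needs a chain rule; hence the detour through differentiability of C^1
   functions. *)
Require Import Defs.
From HB Require Import structures.
From mathcomp Require Import all_boot all_order all_algebra.
From mathcomp Require Import all_classical all_reals all_analysis.
From mathcomp Require Import ring lra.
Set Implicit Arguments.
Unset Strict Implicit.
Unset Printing Implicit Defensive.
Import Order.TTheory GRing.Theory Num.Theory.
Import numFieldNormedType.Exports.
Local Open Scope classical_set_scope.
Local Open Scope ring_scope.

(** * Calculus of iterated directional derivatives *)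

Section CkTheory.
Context {R : realType} {V : normedModType R}.
Implicit Types (W : normedModType R) (U : set V) (k : nat).

Lemma Ck_continuous W k U (f : V -> W) :
  Ck k U f -> forall x, U x -> {for x, continuous f}.
Proof. by case: k => [|k] []. Qed.

Lemma Ck_derivable W k U (f : V -> W) :
  Ck k.+1 U f -> forall v x, U x -> derivable f x v.
Proof. by move=> [_ h] v; have [] := h v. Qed.

Arguments Ck_derivable {W k U f} Cf v [x] : rename.

Lemma Ck_derive W k U (f : V -> W) :
  Ck k.+1 U f -> forall v, Ck k U (fun x => 'D_v f x).
Proof. by move=> [_ h] v; have [] := h v. Qed.

Arguments Ck_derive {W k U f} Cf v : rename.

Lemma Ck_pred W k U (f : V -> W) : Ck k.+1 U f -> Ck k U f.
Proof.
elim: k f => [|k IHk] f Cf; first by split; first exact: Ck_continuous Cf.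
split; first exact: Ck_continuous Cf.
by move=> v; split; [exact: Ck_derivable Cf v|exact/IHk/Ck_derive].
Qed.

Lemma Ck_sub W k U U' (f : V -> W) : U' `<=` U -> Ck k U f -> Ck k U' f.
Proof.
move=> sU; elim: k f => [|k IHk] f Cf.
  by split=> // x /sU; exact: Ck_continuous Cf x.
split=> [x /sU|v]; first exact: Ck_continuous Cf x.
split=> [x /sU|]; first exact: Ck_derivable Cf v x.
exact/IHk/Ck_derive.
Qed.

Lemma open_near_eq W U (f g : V -> W) : open U -> {in U, f =1 g} ->
  forall x, U x -> \forall y \near x, f y = g y.
Proof.
move=> oU fg x Ux; have := open_nbhs_nbhs (conj oU Ux).
by apply: filterS => y Uy; apply: fg; rewrite inE.
Qed.

Lemma continuous_near_eq W (f g : V -> W) x :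
  (\forall y \near x, f y = g y) -> {for x, continuous f} ->
  {for x, continuous g}.
Proof.
move=> fg cf; suff : g @ x --> g x by [].
by rewrite -(nbhs_singleton fg); exact: cvg_trans (near_eq_cvg fg) cf.
Qed.

Lemma Ck_eq W k U (f g : V -> W) : open U -> {in U, f =1 g} ->
  Ck k U f -> Ck k U g.
Proof.
move=> oU; elim: k f g => [|k IHk] f g fg Cf; (split; first by
    move=> x Ux; exact: continuous_near_eq (open_near_eq oU fg Ux)
                                           (Ck_continuous Cf Ux)).
  by [].
move=> v; split.
  move=> x Ux; apply: (near_eq_derivable (open_near_eq oU fg Ux)).
  exact: Ck_derivable Cf v x Ux.
apply: IHk (Ck_derive Cf v) => x; rewrite inE => Ux.
exact/near_eq_derive/(open_near_eq oU fg Ux).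
Qed.

(** Entry point of the inductions on k below: it suffices to exhibit the derivatives by a formula,
    which [Ck_eq] then exchanges for ['D_v f]. *)
Lemma CkS W k U (f : V -> W) (df : V -> V -> W) : open U ->
  (forall x, U x -> {for x, continuous f}) ->
  (forall v x, U x -> is_derive x v f (df v x)) ->
  (forall v, Ck k U (df v)) -> Ck k.+1 U f.
Proof.
move=> oU cf ddf Cdf; split=> // v; split=> [x /(ddf v) []//|].
apply: Ck_eq (Cdf v) => // x; rewrite inE => Ux.
by have [] := ddf v x Ux.
Qed.

Lemma Ck_cst W k U (a : W) : Ck k U (fun _ => a).
Proof.
elim: k a => [|k IHk] a; first by split=> // x _; exact: cst_continuous.
split=> [x _|v]; first exact: cst_continuous.
split=> [x _|]; first exact: derivable_cst.
rewrite [X in Ck _ _ X](_ : _ = fun=> 0); first exact: IHk.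
by apply/funext => x; exact: derive_cst.
Qed.

Lemma Ck_id k U : Ck k U (fun x : V => x).
Proof.
have cid x : U x -> {for x, continuous (fun x : V => x)} by move=> _; exact: cvg_id.
case: k => [|k]; first by split.
split=> [x|v]; [exact: cid|split=> [x _|]; first exact: derivable_id].
rewrite [X in Ck _ _ X](_ : _ = fun=> v); first exact: Ck_cst.
by apply/funext => x; exact: derive_id.
Qed.

Lemma Ck_add W k U (f g : V -> W) : open U -> Ck k U f -> Ck k U g ->
  Ck k U (fun x => f x + g x).
Proof.
move=> oU; elim: k f g => [|k IHk] f g Cf Cg.
  split=> // x Ux; apply: continuousD;
    [exact: Ck_continuous Cf x Ux|exact: Ck_continuous Cg x Ux].
apply: (@CkS _ _ _ _ (fun v x => 'D_v f x + 'D_v g x)) => //.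
- move=> x Ux; apply: continuousD;
    [exact: Ck_continuous Cf x Ux|exact: Ck_continuous Cg x Ux].
- move=> v x Ux; have df := derivableP (Ck_derivable Cf v Ux).
  by have dg := derivableP (Ck_derivable Cg v Ux); exact: is_deriveD.
- by move=> v; apply: IHk; exact: Ck_derive.
Qed.

Lemma Ck_mul k U (f g : V -> R) : open U -> Ck k U f -> Ck k U g ->
  Ck k U (fun x => f x * g x).
Proof.
move=> oU; elim: k f g => [|k IHk] f g Cf Cg.
  split=> // x Ux; apply: continuousM;
    [exact: Ck_continuous Cf x Ux|exact: Ck_continuous Cg x Ux].
apply: (@CkS _ _ _ _ (fun v x => f x * 'D_v g x + g x * 'D_v f x)) => //.
- move=> x Ux; apply: continuousM;
    [exact: Ck_continuous Cf x Ux|exact: Ck_continuous Cg x Ux].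
- move=> v x Ux; have df := derivableP (Ck_derivable Cf v Ux).
  by have dg := derivableP (Ck_derivable Cg v Ux); exact: is_deriveM.
- move=> v; apply: Ck_add => //; apply: IHk;
    by [exact: Ck_pred|exact: Ck_derive].
Qed.

Lemma Ck_sum W k U I (r : seq I) (P : pred I) (f : I -> V -> W) : open U ->
  (forall i, Ck k U (f i)) -> Ck k U (fun x => \sum_(i <- r | P i) f i x).
Proof.
move=> oU Cf; elim: r => [|i r IHr].
  by under eq_fun do rewrite big_nil; exact: Ck_cst.
case Pi: (P i); under eq_fun do rewrite big_cons Pi; last exact: IHr.
exact: Ck_add.
Qed.

Lemma Ck_prod k U I (r : seq I) (P : pred I) (f : I -> V -> R) : open U ->
  (forall i, Ck k U (f i)) -> Ck k U (fun x => \prod_(i <- r | P i) f i x).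
Proof.
move=> oU Cf; elim: r => [|i r IHr].
  by under eq_fun do rewrite big_nil; exact: Ck_cst.
case Pi: (P i); under eq_fun do rewrite big_cons Pi; last exact: IHr.
exact: Ck_mul.
Qed.

Lemma Ck_inv k U (f : V -> R) : open U -> (forall x, U x -> f x != 0) ->
  Ck k U f -> Ck k U (fun x => (f x)^-1).
Proof.
move=> oU f0; have cV : Ck 0 U f -> forall x, U x ->
    {for x, continuous (fun x => (f x)^-1)}.
  by move=> Cf x Ux; apply: continuousV; [exact: f0|exact: Ck_continuous Cf _ Ux].
elim: k => [|k IHk] Cf; first by split=> //; exact: cV.
apply: (@CkS _ _ _ _ (fun v x => (- 1 * ((f x)^-1 * (f x)^-1)) * 'D_v f x)) => //.
- by apply: cV; split=> // x Ux; exact: Ck_continuous Cf _ Ux.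
- move=> v x Ux; have df := Ck_derivable Cf v Ux; split.
    exact: derivableV (f0 _ Ux) df.
  by rewrite deriveV ?f0// -exprVn mulN1r expr2.
- move=> v; apply: Ck_mul => //; last exact: Ck_derive Cf v.
  have CV : Ck k U (fun x => (f x)^-1) by apply/IHk/Ck_pred.
  by apply: Ck_mul => //; [exact: Ck_cst|exact: Ck_mul].
Qed.

Lemma derive_line W (f : V -> W) x v :
  'D_v f x = 'D_1 (fun t : R => f (t *: v + x)) 0.
Proof.
rewrite /derive; set d := (fun h => h^-1 *: (_ - f x)).
set d' := (fun h => h^-1 *: (_ - f (_ + _))); suff -> : d = d' by [].
by apply/funext => t; rewrite /d /d' /= addr0 scale0r add0r [t%:A]mulr1.
Qed.

(** Restricting to the line through x reduces a directional derivative to one real variable, where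
    chain rules are available. *)
Lemma is_derive_lineP W (f : V -> W) x v a :
  is_derive x v f a <-> is_derive (0 : R) 1 (fun t : R => f (t *: v + x)) a.
Proof.
split=> -[df dfa]; split.
- exact: (derivable1P f x v).1.
- by rewrite -derive_line.
- exact: (derivable1P f x v).2.
- by rewrite derive_line.
Qed.

Lemma is_derive_comp1 (f : V -> R) (h : R -> R) x v a b :
  is_derive x v f a -> is_derive (f x) 1 h b -> is_derive x v (h \o f) (b * a).
Proof.
move=> /is_derive_lineP df dh; apply/is_derive_lineP.
apply: (@is_derive1_comp _ h (fun t => f (t *: v + x))) => //.
by rewrite scale0r add0r.
Qed.

Lemma Ck_sqrt k U (f : V -> R) : open U -> (forall x, U x -> 0 < f x) ->
  Ck k U f -> Ck k U (fun x => Num.sqrt (f x)).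
Proof.
move=> oU f0; have cV : Ck 0 U f -> forall x, U x ->
    {for x, continuous (fun x => Num.sqrt (f x))}.
  move=> Cf x Ux; apply: (@continuous_comp _ _ _ f Num.sqrt).
    exact: Ck_continuous Cf _ Ux.
  exact: sqrt_continuous.
elim: k => [|k IHk] Cf; first by split=> //; exact: cV.
apply: (@CkS _ _ _ _ (fun v x => (2 * Num.sqrt (f x))^-1 * 'D_v f x)) => //.
- by apply: cV; split=> // x Ux; exact: Ck_continuous Cf _ Ux.
- move=> v x Ux; have df := derivableP (Ck_derivable Cf v Ux).
  exact/is_derive_comp1/is_derive1_sqrt/f0.
- move=> v; apply: Ck_mul => //; last exact: Ck_derive.
  apply: Ck_inv => //.
    by move=> x Ux; rewrite mulf_neq0// gt_eqF// sqrtr_gt0 f0.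
  by apply: Ck_mul => //; [exact: Ck_cst|exact/IHk/Ck_pred].
Qed.

Lemma mx_continuousP m n (A : V -> 'M[R]_(m, n)) x :
  {for x, continuous A} <-> forall i j, {for x, continuous (fun y => A y i j)}.
Proof.
split=> [cA i j|cA].
  apply: (@continuous_comp _ _ _ A (fun M : 'M[R]_(m, n) => M i j)) => //.
  exact: coord_continuous.
apply/cvgrPdist_le => /= e e0; near=> y.
rewrite /Num.Def.normr/= mx_normrE (bigmax_le _ (ltW e0))//= => ij _.
rewrite !mxE; move: ij; near: y; apply: filter_forall => -[i j] /=.
exact: (cvgrPdist_le _ _).1 (cA i j) _ e0.
Unshelve. all: by end_near. Qed.

Lemma CkmxP k U m n (A : V -> 'M[R]_(m, n)) : open U ->
  Ck k U A <-> forall i j, Ck k U (fun x => A x i j).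
Proof.
move=> oU; elim: k A => [|k IHk] A.
  split=> [[cA _] i j|CA]; split=> // x Ux.
    by have /mx_continuousP := cA x Ux; exact.
  by apply/mx_continuousP => i j; have [+ _] := CA i j; exact.
split=> [CA i j|CA].
  apply: (@CkS _ _ _ _ (fun v x => ('D_v A x) i j)) => //.
  - move=> x Ux; have cA := Ck_continuous CA Ux.
    by have /mx_continuousP := cA; exact.
  - move=> v x Ux; have dA := Ck_derivable CA v Ux; split.
      by have /derivable_mxP := dA; exact.
    by rewrite derive_mx// mxE.
  - by move=> v; have /IHk := Ck_derive CA v; exact.
apply: (@CkS _ _ _ _ (fun v x => 'D_v A x)) => //.
- move=> x Ux; apply/mx_continuousP => i j; exact: Ck_continuous (CA i j) _ Ux.
- move=> v x Ux; apply: derivableP; apply/derivable_mxP => i j.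
  exact: Ck_derivable (CA i j) _ _ Ux.
- move=> v; apply/IHk => i j; apply: Ck_eq (Ck_derive (CA i j) v) => // x.
  rewrite inE => Ux; rewrite derive_mx ?mxE//; apply/derivable_mxP => i' j'.
  exact: Ck_derivable (CA i' j') _ _ Ux.
Qed.

Lemma Ck_mulmx k U m n p (A : V -> 'M[R]_(m, n)) (B : V -> 'M[R]_(n, p)) :
  open U -> Ck k U A -> Ck k U B -> Ck k U (fun x => A x *m B x).
Proof.
move=> oU /CkmxP => /(_ oU) CA /CkmxP => /(_ oU) CB.
apply/CkmxP => // i j; under eq_fun do rewrite mxE.
by apply: Ck_sum => // l; exact: Ck_mul.
Qed.

Lemma Ck_scale k U m n (f : V -> R) (A : V -> 'M[R]_(m, n)) :
  open U -> Ck k U f -> Ck k U A -> Ck k U (fun x => f x *: A x).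
Proof.
move=> oU Cf /CkmxP => /(_ oU) CA; apply/CkmxP => // i j.
by under eq_fun do rewrite mxE; exact: Ck_mul.
Qed.

Lemma Ck_oppmx k U m n (A : V -> 'M[R]_(m, n)) :
  open U -> Ck k U A -> Ck k U (fun x => - A x).
Proof.
move=> oU CA; under eq_fun do rewrite -scaleN1r.
by apply: Ck_scale => //; exact: Ck_cst.
Qed.

Lemma Ck_trmx k U m n (A : V -> 'M[R]_(m, n)) :
  open U -> Ck k U A -> Ck k U (fun x => (A x)^T).
Proof.
move=> oU /CkmxP => /(_ oU) CA; apply/CkmxP => // i j.
by under eq_fun do rewrite mxE; exact: CA.
Qed.

Lemma Ck_det k U n (A : V -> 'M[R]_n) :
  open U -> Ck k U A -> Ck k U (fun x => \det (A x)).
Proof.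
move=> oU /CkmxP => /(_ oU) CA; apply: Ck_sum => // s.
by apply: Ck_mul => //; [exact: Ck_cst|exact: Ck_prod].
Qed.

Lemma Ck_invmx k U n (A : V -> 'M[R]_n) :
  open U -> (forall x, U x -> A x \in unitmx) ->
  Ck k U A -> Ck k U (fun x => invmx (A x)).
Proof.
move=> oU uA CA.
(* Cramer's rule: the entries of the inverse are polynomials in those of [A x] divided by the
   determinant. *)
apply: (@Ck_eq _ _ _ (fun x => (\det (A x))^-1 *: \adj (A x))) => //.
  by move=> x; rewrite inE => Ux; rewrite /invmx uA.
apply: Ck_scale => //.
  apply: Ck_inv => //; last exact: Ck_det.
  by move=> x /uA; rewrite unitmxE unitfE.
apply/CkmxP => // i j; under eq_fun do rewrite mxE.
apply: Ck_mul => //; first exact: Ck_cst.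
apply: Ck_det => //; apply/CkmxP => // i' j'; under eq_fun do rewrite !mxE.
by move: CA => /CkmxP; exact.
Qed.

Lemma is_derive_pair (W1 W2 : normedModType R) (f : V -> W1) (g : V -> W2)
    x v df dg : is_derive x v f df -> is_derive x v g dg ->
  is_derive x v (fun y => (f y, g y)) (df, dg).
Proof.
move=> [Df <-] [Dg <-]; pose fg y := (f y, g y).
have h : (fun t : R => t^-1 *: ((fg \o shift x) (t *: v) - fg x)) @ 0^' -->
    ('D_v f x, 'D_v g x) by exact: cvg_pair Df Dg.
split; first by apply/cvg_ex; exists ('D_v f x, 'D_v g x); exact: h.
by apply: cvg_lim h; exact: norm_hausdorff.
Qed.

Lemma Ck_pair (W1 W2 : normedModType R) k U (f : V -> W1) (g : V -> W2) :
  open U -> Ck k U f -> Ck k U g -> Ck k U (fun x => (f x, g x)).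
Proof.
move=> oU; elim: k f g => [|k IHk] f g Cf Cg.
  split=> // x Ux; apply: cvg_pair;
    [exact: Ck_continuous Cf x Ux|exact: Ck_continuous Cg x Ux].
apply: (@CkS _ _ _ _ (fun v x => ('D_v f x, 'D_v g x))) => //.
- move=> x Ux; apply: cvg_pair;
    [exact: Ck_continuous Cf x Ux|exact: Ck_continuous Cg x Ux].
- move=> v x Ux; apply: is_derive_pair; apply: derivableP;
    [exact: Ck_derivable Cf v x Ux|exact: Ck_derivable Cg v x Ux].
- by move=> v; apply: IHk; exact: Ck_derive.
Qed.

Lemma is_derive_mxP m n (A : V -> 'M[R]_(m, n)) x v (dA : 'M[R]_(m, n)) :
  is_derive x v A dA <-> forall i j, is_derive x v (fun y => A y i j) (dA i j).
Proof.
split=> [[DA <-] i j|DA].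
  split; first by have /derivable_mxP := DA; exact.
  by rewrite derive_mx// mxE.
have dAx : derivable A x v by apply/derivable_mxP => i j; have [] := DA i j.
split=> //; rewrite derive_mx//; apply/matrixP => i j; rewrite mxE.
by have [] := DA i j.
Qed.

Lemma is_derive_mulmx m n p (A : V -> 'M[R]_(m, n)) (B : V -> 'M[R]_(n, p))
    x v dA dB : is_derive x v A dA -> is_derive x v B dB ->
  is_derive x v (fun y => A y *m B y) (dA *m B x + A x *m dB).
Proof.
move=> /is_derive_mxP DA /is_derive_mxP DB; apply/is_derive_mxP => i j.
rewrite (_ : (fun y => _) = \sum_(l < n) (fun y => A y i l * B y l j)).
  have -> : (dA *m B x + A x *m dB) i j =
      \sum_(l < n) (A x i l *: dB l j + B x l j *: dA i l).
    rewrite !mxE -big_split/=; apply: eq_bigr => l _.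
    by rewrite addrC [X in _ + X]mulrC.
  by apply: is_derive_sum => l; apply: is_deriveM.
by apply/funext => y; rewrite mxE fct_sumE.
Qed.

Lemma open_unitmx U n (A : V -> 'M[R]_n) : open U -> Ck 0 U A ->
  open (U `&` [set x | A x \in unitmx]).
Proof.
move=> oU CA; rewrite openE => x [Ux Ax].
have cd := Ck_continuous (Ck_det oU CA) Ux.
apply: filterI; first exact: open_nbhs_nbhs.
have : \forall y \near x, \det (A y) != 0.
  apply: (cd [set d : R | d != 0]); apply: open_nbhs_nbhs; split; first exact: open_neq.
  by move: Ax; rewrite /= unitmxE unitfE.
by apply: filterS => y; rewrite /= unitmxE unitfE.
Qed.

Lemma is_derive_invmx U n (A : V -> 'M[R]_n) x v dA :
  open U -> Ck 1 U A -> (forall y, U y -> A y \in unitmx) -> U x ->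
  is_derive x v A dA ->
  is_derive x v (fun y => invmx (A y)) (- (invmx (A x) *m dA *m invmx (A x))).
Proof.
move=> oU CA uA Ux DA; have CV := Ck_invmx oU uA CA.
have DV := derivableP (Ck_derivable CV v Ux).
split; first by have [] := DV.
have [_ D1] := is_derive_mulmx DA DV.
(* Differentiating A A^-1 = 1 determines the derivative of the inverse, whose existence is already
   known. *)
have D0 : 'D_v (fun y => A y *m invmx (A y)) x = 0.
  rewrite -(derive_cst (1%:M : 'M[R]_n) x v); apply: near_eq_derive.
  apply: filterS (open_nbhs_nbhs (conj oU Ux)) => y Uy.
  by rewrite mulmxV ?uA.
move: D1; rewrite D0 => /esym/eqP; rewrite addrC addr_eq0 => /eqP D1.
by rewrite -mulmxA -mulmxN -D1 mulKmx ?uA.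
Qed.

End CkTheory.

(** * Continuously differentiable functions *)

Section Lines.
Context {R : realType} {V W : normedModType R}.
Implicit Types (f : V -> W) (a v : V) (t w : R^o).

Lemma line_quotient f a v t w :
  (fun h : R => h^-1 *: (((fun s : R^o => f (s *: v + a)) \o shift t) (h *: w)
                         - f (t *: v + a))) =
  (fun h : R => h^-1 *: ((f \o shift (t *: v + a)) (h *: (w *: v))
                         - f (t *: v + a))).
Proof.
by apply/funext => h /=; rewrite scalerDl addrA scalerA.
Qed.

Lemma derivable_line f a v t w :
  derivable (fun s : R^o => f (s *: v + a)) t w <->
  derivable f (t *: v + a) (w *: v).
Proof. by rewrite /derivable line_quotient. Qed.

Lemma derive_along_line f a v t w :
  'D_w (fun s : R^o => f (s *: v + a)) t = 'D_(w *: v) f (t *: v + a).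
Proof. by rewrite /derive line_quotient. Qed.

Lemma line_continuous a v : continuous (fun t : R^o => t *: v + a).
Proof.
move=> t; apply: cvgD; last exact: cvg_cst.
exact: scalel_continuous.
Qed.

Lemma open_line U a v : open U -> open [set t : R^o | U (t *: v + a)].
Proof. by move=> oU; apply: open_comp => // t _; exact: line_continuous. Qed.

(** Homogeneity in the direction concerns a single line, and on a line derivable functions are
    differentiable. *)
Lemma deriveZdir f a v (k : R) : derivable f a v -> 'D_(k *: v) f a = k *: 'D_v f a.
Proof.
move=> df; have da : derivable (fun s : R^o => f (s *: v + a)) (0 : R^o) (1 : R^o).
  by apply/derivable_line; rewrite scale0r add0r scale1r.
have := derive_along_line f a v 0 k; rewrite scale0r add0r => <-.
have := derive_along_line f a v 0 1; rewrite scale0r add0r scale1r => <-.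
have /derivable1_diffP d := da.
by rewrite !deriveE// -[X in 'd _ _ X = _]mulr1 [LHS]linearZ.
Qed.

End Lines.

Lemma Ck_line {R : realType} {V W : normedModType R} k U (f : V -> W) a v :
  Ck k U f ->
  Ck k [set t : R^o | U (t *: v + a)] (fun t : R^o => f (t *: v + a)).
Proof.
elim: k f => [|k IHk] f Cf; (split; first by move=> t Ut;
  apply: (@continuous_comp _ _ _ (fun t : R^o => t *: v + a) f);
  [exact: line_continuous|exact: Ck_continuous Cf _ Ut]); first by [].
move=> w; split=> [t Ut|]; first exact/derivable_line/(Ck_derivable Cf).
rewrite [X in Ck k _ X](_ : _ = (fun t : R^o => (fun x => 'D_(w *: v) f x) (t *: v + a))).
  exact: IHk (Ck_derive Cf (w *: v)).
by apply/funext => t; exact: derive_along_line.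
Qed.

Section C1.
Context {R : realType}.

Lemma entry_le_norm m n (B : 'M[R]_(m, n)) i j : `|B i j| <= `|B|.
Proof.
rewrite [leRHS]/Num.Def.normr/= mx_normrE.
exact: (le_bigmax _ (fun ij : 'I_m * 'I_n => `|B ij.1 ij.2|) (i, j)).
Qed.

Lemma mx_norm_le m n (A B : 'M[R]_(m, n)) :
  (forall i j, `|A i j| <= `|B i j|) -> `|A| <= `|B|.
Proof.
move=> AB; rewrite [leLHS]/Num.Def.normr/= mx_normrE.
rewrite (bigmax_le _ (normr_ge0 B))//= => -[i j] _ /=.
by apply: le_trans (AB i j) _; exact: entry_le_norm.
Qed.

Lemma mean_value_line (V : normedModType R) (f : V -> R) (a w : V) :
  (forall s : R, 0 <= s <= 1 -> derivable f (s *: w + a) w) ->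
  exists2 s : R, 0 <= s <= 1 & f (w + a) - f a = 'D_w f (s *: w + a).
Proof.
move=> df; pose phi (s : R) : R := f (s *: w + a).
have dphi (s : R) : 0 <= s <= 1 -> is_derive s 1 phi ('D_w f (s *: w + a)).
  move=> s01; split.
    by apply/(derivable_line f a w s 1); rewrite scale1r; exact: df.
  by have := derive_along_line f a w s 1; rewrite scale1r.
have [|s||s s01] := @MVT_segment _ phi (fun s => 'D_w f (s *: w + a)) 0 1.
- exact: ler01.
- by rewrite in_itv/= => /andP[s0 s1]; apply: dphi; rewrite !ltW.
- apply: derivable_within_continuous => s; rewrite in_itv/= => s01.
  by have [] := dphi s s01.
- rewrite subr0 mulr1 /phi scale1r scale0r add0r => ->.
  by exists s => //; move: s01; rewrite in_itv.
Qed.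

Lemma differentiable_linear_approx (V W : normedModType R) (f : V -> W)
    (df : {linear V -> W}) (x : V) : continuous df ->
  (forall e : R, 0 < e -> \forall h \near (0 : V),
    `|f (h + x) - (f x + df h)| <= e * `|h|) ->
  differentiable f x.
Proof.
move=> cdf fdf.
have fo : f \o shift x = cst (f x) + df +o_ 0 id.
  by apply/eqaddoP => e e0; exact: fdf.
by apply/diff_locallyP; rewrite (diff_unique cdf fo).
Qed.

(** The image of a line under [phi] need not be straight, so derivability of [f] in every direction
    would not do: full differentiability is required. *)
Lemma is_derive_comp (V W : normedModType R) (U : normedModType R)
    (phi : V -> W) (f : W -> U) x v dphi :
  is_derive x v phi dphi -> differentiable f (phi x) ->
  is_derive x v (f \o phi) ('D_dphi f (phi x)).
Proof.
move=> /is_derive_lineP[dp pv] df; apply/is_derive_lineP.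
pose l (t : R) := phi (t *: v + x).
have l0 : l 0 = phi x by rewrite /l scale0r add0r.
have dl : differentiable l (0 : R) by apply/derivable1_diffP.
have df' : differentiable f (l 0) by rewrite l0.
have dfl : differentiable (f \o l) (0 : R) by exact: differentiable_comp.
split; first exact/derivable1_diffP.
by rewrite (deriveE _ dfl) diff_comp//= -(deriveE _ dl) pv -(deriveE _ df') l0.
Qed.

Section gradient.
Variables (n : nat) (f : 'cV[R]_n -> R^o) (y : 'cV[R]_n).

Definition gradient (h : 'cV[R]_n) : R^o :=
  \sum_(i < n) h i ord0 * 'D_(delta_mx i ord0) f y.

Fact gradient_linear : linear (gradient : 'cV[R]_n -> R^o).
Proof.
move=> a u v; rewrite /gradient scaler_sumr -big_split/=.
by apply: eq_bigr => i _; rewrite !mxE mulrDl -mulrA.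
Qed.

HB.instance Definition _ := GRing.isLinear.Build R 'cV[R]_n R^o _ gradient
  gradient_linear.

Lemma gradient_continuous : continuous gradient.
Proof.
move=> x; have : Ck 0 setT gradient.
  apply: Ck_sum => [|i]; first exact: openT.
  apply: Ck_mul; [exact: openT| |exact: Ck_cst].
  by split=> // z _; exact: coord_continuous.
by move/Ck_continuous; exact.
Qed.

End gradient.

Section C1_differentiable.
Variables (n : nat) (f : 'cV[R]_n -> R^o) (U : set 'cV[R]_n) (y : 'cV[R]_n).
Hypotheses (oU : open U) (Cf : Ck 1 U f) (Uy : U y).

(** The corners of a path from 0 to h along the coordinate axes; consecutive corners differ in one
    coordinate. *)
Let trunc (h : 'cV[R]_n) (k : nat) : 'cV[R]_n :=
  \col_j (if (j < k)%N then h j ord0 else 0).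

Let truncS h (i : 'I_n) : trunc h i.+1 = h i ord0 *: delta_mx i ord0 + trunc h i.
Proof.
apply/colP => j; rewrite !mxE andbT ltnS leq_eqVlt.
have [/val_inj ->|ji] /= := eqVneq (j : nat) i.
  by rewrite eqxx ltnn mulr1 addr0.
by rewrite -(inj_eq val_inj) (negPf ji) mulr0 add0r.
Qed.

(** The increment telescopes along the axis-parallel path. On each edge the mean value theorem
    yields a partial derivative at a nearby point, and continuity of the partials compares it with
    the one at y. *)
Lemma C1_gradient (e : R) : 0 < e -> \forall h \near (0 : 'cV[R]_n),
  `|f (h + y) - (f y + gradient f y h)| <= e * `|h|.
Proof.
(* Each of the n edges contributes an error of at most [e'] times the norm of h; the denominator n +
   1 covers their sum and is nonzero even for n = 0. *)
move=> e0; pose e' := e / n.+1%:R.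
have e'0 : 0 < e' by rewrite divr_gt0.
have : \forall z \near y, U z /\
    forall i : 'I_n, `|'D_(delta_mx i ord0) f y - 'D_(delta_mx i ord0) f z| <= e'.
  near=> z; split; first by near: z; exact: open_nbhs_nbhs.
  near: z; apply: filter_forall => i.
  have := Ck_continuous (Ck_derive Cf (delta_mx i ord0)) Uy.
  by move=> /cvgrPdist_le/(_ _ e'0).
move=> /nbhs_ballP[d /= d0 dU]; apply/nbhs_ballP; exists d => //= h.
rewrite -ball_normE /= sub0r normrN => hd.
have dz z : `|z| <= `|h| -> U (z + y) /\
    forall i : 'I_n, `|'D_(delta_mx i ord0) f y -
                       'D_(delta_mx i ord0) f (z + y)| <= e'.
  move=> zh; apply: dU; rewrite -ball_normE /=.
  by rewrite opprD addrCA subrr addr0 normrN (le_lt_trans zh).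
have step (i : 'I_n) : `|f (trunc h i.+1 + y) - f (trunc h i + y) -
    h i ord0 * 'D_(delta_mx i ord0) f y| <= `|h| * e'.
  pose w := h i ord0 *: delta_mx i ord0 : 'cV[R]_n.
  (* In the sup norm no point of the path is farther from 0 than h, so the estimate on the partials
     applies along every edge. *)
  have small (s : R) : 0 <= s <= 1 -> `|s *: w + trunc h i| <= `|h|.
    move=> /andP[s0 s1]; apply: mx_norm_le => j k; rewrite (ord1 k) !mxE andbT.
    have [->|ji] := eqVneq j i; last first.
      by rewrite !mulr0 add0r; case: ifP => // _; rewrite normr0.
    by rewrite ltnn addr0 mulr1 normrM ger0_norm// ler_piMl.
  have [s s01|s s01] := @mean_value_line _ f (trunc h i + y) w.
    by rewrite addrA; apply: (Ck_derivable Cf); have [] := dz _ (small s s01).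
  have -> : trunc h i.+1 + y = w + (trunc h i + y) by rewrite truncS addrA.
  move=> ->; rewrite addrA.
  have [Us Ds] := dz _ (small s s01).
  rewrite deriveZdir; last exact: (Ck_derivable Cf).
  rewrite -[_ *: _]/(_ * _) -mulrBr normrM distrC.
  by rewrite ler_pM//; exact: entry_le_norm.
have t0 : trunc h 0 = 0 by apply/colP => j; rewrite !mxE.
have tn : trunc h n = h by apply/colP => j; rewrite !mxE ltn_ord.
have -> : f (h + y) - (f y + gradient f y h) = \sum_(i < n)
    (f (trunc h i.+1 + y) - f (trunc h i + y) -
     h i ord0 * 'D_(delta_mx i ord0) f y).
  rewrite sumrB opprD addrA; congr (_ - _).
  rewrite -(big_mkord xpredT (fun i => f (trunc h i.+1 + y) - f (trunc h i + y))).
  by rewrite (telescope_sumr (fun i => f (trunc h i + y)))// t0 tn add0r.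
apply: le_trans (ler_norm_sum _ _ _) _.
apply: le_trans (ler_sum _ (fun i _ => step i)) _.
rewrite sumr_const card_ord -mulr_natr -mulrA mulrC ler_wpM2r//.
rewrite /e' -mulrA ler_piMr//; first exact: ltW.
by rewrite mulrC ler_pdivrMr// mul1r ler_nat.
Unshelve. all: by end_near. Qed.

Lemma C1_differentiable : differentiable f y.
Proof.
exact: (@differentiable_linear_approx _ _ _ (gradient f y) _
          (@gradient_continuous n f y) C1_gradient).
Qed.

End C1_differentiable.
Lemma derive_basis n (W : normedModType R) (f : 'cV[R]_n -> W) x
    (u : 'cV[R]_n) : differentiable f x ->
  'D_u f x = \sum_(i < n) u i ord0 *: 'D_(delta_mx i ord0) f x.
Proof.
move=> df; rewrite (deriveE _ df) [in LHS](matrix_sum_delta u) linear_sum.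
apply: eq_bigr => i _; rewrite big_ord1 linearZ (deriveE _ df).
by [].
Qed.

End C1.

(** * Tensors and frames in charts *)

(* [coord] and [coord_continuous] also exist in MathComp. *)
Import Defs.

Section Manifold.
Context {R : realType} {n : nat} {M : manifold R n}.
Implicit Types (c d e : chart M) (X Y : vector_field M) (F G : endo_field M).

Lemma open_overlap c (A : set M) : open A -> open (coord c @` (dom c `&` A)).
Proof.
move=> oA; rewrite openE => _ [q [cq Aq] <-].
have cont := param_continuous cq.
have : \forall x \near coord c q, (coord c @` dom c) x /\ A (param c x).
  apply: filterI.
    by apply: open_nbhs_nbhs; split; [exact: coord_open|exists q].
  apply: (cont A); rewrite coordK//.
  exact: open_nbhs_nbhs.
apply: filterS => _ [[q' cq' <-]]; rewrite coordK// => Aq'.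
by exists q'.
Qed.

Lemma chart_changeE c d q : dom c q -> dom d q ->
  \forall x \near coord c q, (coord c @` (dom c `&` dom d)) x.
Proof.
move=> cq dq; apply: open_nbhs_nbhs; split; last by exists q.
exact/open_overlap/dom_open.
Qed.

Lemma Ck_chart_change k c d :
  Ck k (coord c @` (dom c `&` dom d)) (coord d \o param c).
Proof. exact: chart_compatible. Qed.

Lemma chart_jacobian_id c q : dom c q -> chart_jacobian c c q = 1%:M.
Proof.
move=> cq; apply/matrixP => i j; rewrite !mxE.
rewrite (near_eq_derive (g := id)) ?derive_id ?mxE ?andbT//.
apply: filterS (chart_changeE cq cq) => _ [q' [cq' _] <-] /=.
by rewrite coordK.
Qed.

Lemma chart_change_differentiable d e q i : dom d q -> dom e q ->
  differentiable (fun x => (coord e (param d x)) i ord0 : R^o) (coord d q).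
Proof.
move=> dq eq; have oU : open (coord d @` (dom d `&` dom e)).
  exact/open_overlap/dom_open.
apply: (C1_differentiable oU); last by exists q.
by have /CkmxP := Ck_chart_change 1 d e; exact.
Qed.

Lemma chart_change_derive c d q i j : dom c q -> dom d q ->
  is_derive (coord c q) (delta_mx j ord0)
    (fun x => (coord d (param c x)) i ord0) (chart_jacobian c d q i j).
Proof.
move=> cq dq; have Cd := Ck_derivable (Ck_chart_change 1 c d).
have Uq : (coord c @` (dom c `&` dom d)) (coord c q) by exists q.
have /is_derive_mxP := derivableP (Cd (delta_mx j ord0) _ Uq).
by move/(_ i ord0); rewrite mxE.
Qed.

(** The cocycle rule: near the point [coord e \o param c] factors through the chart d, and the chain
    rule applies. *)
Lemma chart_jacobian_comp c d e q : dom c q -> dom d q -> dom e q ->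
  chart_jacobian d e q *m chart_jacobian c d q = chart_jacobian c e q.
Proof.
move=> cq dq eq; apply/matrixP => i j; rewrite mxE.
have [_ <-] := chart_change_derive i j cq eq.
pose psi x : R^o := (coord e (param d x)) i ord0.
pose phi := coord d \o param c.
have dphi : is_derive (coord c q) (delta_mx j ord0) phi
    (\col_l chart_jacobian c d q l j).
  apply/is_derive_mxP => l z; rewrite (ord1 z) !mxE.
  by have := chart_change_derive l j cq dq; rewrite mxE.
have phiq : phi (coord c q) = coord d q by rewrite /phi/= coordK.
have dpsi : differentiable psi (phi (coord c q)).
  by rewrite phiq; exact: chart_change_differentiable.
rewrite (near_eq_derive (g := psi \o phi)); last first.
  apply: filterS (chart_changeE cq dq) => _ [q' [cq' dq'] <-] /=.
  by rewrite /psi /phi /= !coordK.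
have [_ ->] := is_derive_comp dphi dpsi.
rewrite derive_basis// phiq; apply: eq_bigr => l _.
have [_ ->] := chart_change_derive i l dq eq.
by rewrite mxE mulrC.
Qed.

Lemma chart_jacobian_inv c d q : dom c q -> dom d q ->
  chart_jacobian d c q *m chart_jacobian c d q = 1%:M.
Proof. by move=> cq dq; rewrite chart_jacobian_comp// chart_jacobian_id. Qed.

Lemma Ck_chart_jacobian k c d :
  Ck k (coord c @` (dom c `&` dom d)) (chart_jacobian c d \o param c).
Proof.
have oU : open (coord c @` (dom c `&` dom d)) by exact/open_overlap/dom_open.
apply/CkmxP => // i j.
apply: (@Ck_eq _ _ _ _ _ (fun x =>
   ('D_(delta_mx j ord0) (coord d \o param c) x) i ord0)) => //.
  by move=> x; rewrite inE => -[q [cq _] <-]; rewrite mxE/= coordK.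
by have /CkmxP := Ck_derive (Ck_chart_change k.+1 c d) (delta_mx j ord0); exact.
Qed.

Lemma vector_rep_at X p : vector_rep (chart_at p) X p = X p.
Proof. by rewrite /vector_rep chart_jacobian_id ?mul1mx//; exact: chart_atP. Qed.

Lemma endo_rep_at F p : endo_rep (chart_at p) F p = F p.
Proof.
by rewrite /endo_rep chart_jacobian_id ?mul1mx ?mulmx1//; exact: chart_atP.
Qed.

Lemma vector_rep_app c F X q : dom c q ->
  vector_rep c (F \app X) q = endo_rep c F q *m vector_rep c X q.
Proof.
move=> cq; rewrite /vector_rep /endo_rep !mulmxA; congr (_ *m _).
by rewrite -[RHS]mulmxA chart_jacobian_inv ?mulmx1//; exact: chart_atP.
Qed.

Lemma endo_rep_mul c F G q : dom c q ->
  endo_rep c (fun p => F p *m G p) q = endo_rep c F q *m endo_rep c G q.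
Proof.
move=> cq; rewrite /endo_rep !mulmxA; congr (_ *m _ *m _).
by rewrite -[RHS]mulmxA chart_jacobian_inv ?mulmx1//; exact: chart_atP.
Qed.

Lemma endo_rep_add c F G q :
  endo_rep c (fun p => F p + G p) q = endo_rep c F q + endo_rep c G q.
Proof. by rewrite /endo_rep mulmxDr mulmxDl. Qed.

Lemma endo_rep_scale c (a : R) F q :
  endo_rep c (fun p => a *: F p) q = a *: endo_rep c F q.
Proof. by rewrite /endo_rep -scalemxAr -scalemxAl. Qed.

Lemma endo_rep_one c q : dom c q -> endo_rep c (fun _ : M => 1%:M) q = 1%:M.
Proof.
by move=> cq; rewrite /endo_rep mulmx1 chart_jacobian_inv//; exact: chart_atP.
Qed.

Lemma smooth_repP (W : normedModType R) (rep : chart M -> M -> W) :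
  smooth_rep rep <-> forall k c, Ck k (coord c @` dom c) (rep c \o param c).
Proof. by split=> h c k; exact: h. Qed.

Lemma Ck_rep_eq (W : normedModType R) k c (f g : M -> W) :
  (forall q, dom c q -> f q = g q) ->
  Ck k (coord c @` dom c) (f \o param c) -> Ck k (coord c @` dom c) (g \o param c).
Proof.
move=> fg; apply: Ck_eq; first exact: coord_open.
by move=> _ /[1!inE] -[q cq <-] /=; rewrite coordK// fg.
Qed.

Lemma smooth_app F X : smooth_endo F -> smooth_vf X -> smooth_vf (F \app X).
Proof.
move=> sF sX; apply/smooth_repP => k c.
apply: (@Ck_rep_eq _ _ _ (fun q => endo_rep c F q *m vector_rep c X q)).
  by move=> q cq; rewrite vector_rep_app.
by apply: Ck_mulmx; [exact: coord_open|exact: sF|exact: sX].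
Qed.

Lemma smooth_endo_mul F G : smooth_endo F -> smooth_endo G ->
  smooth_endo (fun p => F p *m G p).
Proof.
move=> sF sG; apply/smooth_repP => k c.
apply: (@Ck_rep_eq _ _ _ (fun q => endo_rep c F q *m endo_rep c G q)).
  by move=> q cq; rewrite endo_rep_mul.
by apply: Ck_mulmx; [exact: coord_open|exact: sF|exact: sG].
Qed.

Lemma smooth_endo_add F G : smooth_endo F -> smooth_endo G ->
  smooth_endo (fun p => F p + G p).
Proof.
move=> sF sG; apply/smooth_repP => k c.
apply: (@Ck_rep_eq _ _ _ (fun q => endo_rep c F q + endo_rep c G q)).
  by move=> q cq; rewrite endo_rep_add.
by apply: Ck_add; [exact: coord_open|exact: sF|exact: sG].
Qed.

Lemma smooth_endo_scale (a : R) F : smooth_endo F ->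
  smooth_endo (fun p => a *: F p).
Proof.
move=> sF; apply/smooth_repP => k c.
apply: (@Ck_rep_eq _ _ _ (fun q => a *: endo_rep c F q)).
  by move=> q cq; rewrite endo_rep_scale.
by apply: Ck_scale; [exact: coord_open|exact: Ck_cst|exact: sF].
Qed.

Lemma smooth_endo_one : smooth_endo (fun _ : M => 1%:M).
Proof.
apply/smooth_repP => k c.
apply: (@Ck_rep_eq _ _ _ (fun q => 1%:M)); last exact: Ck_cst.
by move=> q cq; rewrite endo_rep_one.
Qed.

(* A frame field along the straight chart line through p with velocity v, given
   by its matrix in the chart at p. *)
Definition line_point p (v : 'cV[R]_n) (t : R^o) : M :=
  param (chart_at p) (t *: v + coord (chart_at p) p).

Definition line_frame p v (u : R^o -> 'M[R]_n) (t : R^o) : frame M :=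
  let q := line_point p v t in
  (q, chart_jacobian (chart_at p) (chart_at q) q *m u t).

Definition line_domain (p : M) (v : 'cV[R]_n) : set R^o :=
  [set t | (coord (chart_at p) @` dom (chart_at p))
             (t *: v + coord (chart_at p) p)].

Lemma line_domain_open p v : open (line_domain p v).
Proof. exact/open_line/coord_open. Qed.

Lemma line_domain0 p v : line_domain p v 0.
Proof. by rewrite /line_domain/= scale0r add0r; exists p => //; exact: chart_atP. Qed.

Lemma line_point0 p v : line_point p v 0 = p.
Proof. by rewrite /line_point scale0r add0r coordK//; exact: chart_atP. Qed.

Lemma line_point_dom p v t : line_domain p v t ->
  dom (chart_at p) (line_point p v t).
Proof. by rewrite /line_point => -[q cq <-]; rewrite coordK. Qed.

Lemma line_pointK p v t : line_domain p v t ->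
  coord (chart_at p) (line_point p v t) = t *: v + coord (chart_at p) p.
Proof. by rewrite /line_point => -[q cq <-]; rewrite coordK. Qed.

Lemma line_frame0 p v u : line_frame p v u 0 = (p, u 0).
Proof.
by rewrite /line_frame/= line_point0 chart_jacobian_id ?mul1mx//; exact: chart_atP.
Qed.

(** The chart chosen at the moving point may jump arbitrarily with t. The cocycle rule eliminates
    it, and only then can smoothness of the curve be read off. *)
Lemma bundle_chart_line c p v u t : line_domain p v t ->
  dom c (line_point p v t) ->
  bundle_chart c (line_frame p v u t) =
  (coord c (line_point p v t),
   chart_jacobian (chart_at p) c (line_point p v t) *m u t).
Proof.
move=> Dt ct; rewrite /bundle_chart/= mulmxA chart_jacobian_comp//.
  exact: line_point_dom.
exact: chart_atP.
Qed.

Lemma smooth_line_frame p v (O : set R^o) u : open O ->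
  O `<=` line_domain p v -> smooth_on O u ->
  smooth_frame_map O (line_frame p v u).
Proof.
move=> oO OD su c.
pose U := coord (chart_at p) @` (dom (chart_at p) `&` dom c).
have -> : O `&` [set s | dom c (line_frame p v u s).1] =
    O `&` [set t : R^o | U (t *: v + coord (chart_at p) p)].
  rewrite eqEsubset; split=> t [Ot] /=.
    move=> ct; split=> //; exists (line_point p v t).
      by split=> //; exact/line_point_dom/OD.
    exact/line_pointK/OD.
  by move=> [q [pq cq] qt]; split=> //; rewrite /line_point -qt coordK.
have oU : open U by exact/open_overlap/dom_open.
have oO' : open (O `&` [set t : R^o | U (t *: v + coord (chart_at p) p)]).
  by apply: openI => //; exact: open_line.
split=> // k; apply: (@Ck_eq _ _ _ _ _ (fun t =>
  (coord c (line_point p v t),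
   chart_jacobian (chart_at p) c (line_point p v t) *m u t))) => //.
  move=> t; rewrite inE => -[Ot [q [pq cq] qt]].
  rewrite /= bundle_chart_line//; first exact: OD.
  by rewrite /line_point -qt coordK.
apply: Ck_pair => //.
  apply: Ck_sub (@subIsetr _ _ _) _.
  exact: (Ck_line _ _ (Ck_chart_change k (chart_at p) c)).
apply: Ck_mulmx => //; last by apply: Ck_sub (@subIsetl _ _ _) _; exact: su.
apply: Ck_sub (@subIsetr _ _ _) _.
exact: (Ck_line _ _ (Ck_chart_jacobian k (chart_at p) c)).
Qed.

Lemma velocity_line_frame p v (O : set R^o) u : open O -> O 0 ->
  O `<=` line_domain p v -> smooth_on O u ->
  velocity (line_frame p v u) 0 1 = (v, 'D_1 u 0).
Proof.
move=> oO O0 OD su; rewrite /velocity line_frame0/=.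
rewrite (near_eq_derive (g := fun t : R^o => (t *: v + coord (chart_at p) p, u t))).
  apply: derive_val; apply: is_derive_pair; last first.
    by apply: derivableP; exact: Ck_derivable (su 1%N) _ _ O0.
  have := derive_along_line id (coord (chart_at p) p) v 0 1.
  rewrite derive_id scale1r => dv; split=> //.
  by apply: (derivable_line id (coord (chart_at p) p) v 0 1).2; exact: derivable_id.
apply: filterS (open_nbhs_nbhs (conj oO O0)) => t /OD Dt.
rewrite /= bundle_chart_line//; last exact: line_point_dom.
by rewrite line_pointK// chart_jacobian_id ?mul1mx//; exact: line_point_dom.
Qed.

Lemma tangent_line (Q : set (frame M)) p v (O : set R^o) u : open O -> O 0 ->
  O `<=` line_domain p v -> smooth_on O u ->
  (forall t, O t -> Q (line_frame p v u t)) ->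
  tangent Q (p, u 0) (v, 'D_1 u 0).
Proof.
move=> oO O0 OD su Qu; exists O, (line_frame p v u); split=> //.
- exact: smooth_line_frame.
- exact: line_frame0.
- exact: velocity_line_frame OD su.
Qed.

(* In the chart at p, a horizontal lift (v, B) at the frame u contributes the
   zeroth-order term - B u^-1 Y. *)
Lemma covariant_derivativeE Q omega nabla X Y z Z :
  covariant_derivative_of Q omega nabla -> smooth_vf X -> smooth_vf Y ->
  Q z -> tangent Q z Z -> omega z Z = 0 -> Z.1 = X z.1 -> z.2 \in unitmx ->
  nabla X Y z.1 =
    'D_(X z.1) (vector_rep (chart_at z.1) Y \o param (chart_at z.1))
      (coord (chart_at z.1) z.1)
    - Z.2 *m invmx z.2 *m Y z.1.
Proof.
move=> cov sX sY Qz tZ oZ ZX uz; rewrite (cov X Y sX sY z Z)//.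
set c := chart_at z.1; set x := coord c z.1.
have cz : dom c z.1 by exact: chart_atP.
pose b := vector_rep c Y \o param c.
have dU : open (coord c @` dom c) by exact: coord_open.
have Db : is_derive (0 : R^o) 1 (fun t : R^o => b (t *: Z.1 + x)) ('D_(X z.1) b x).
  have Cb : Ck 1 (coord c @` dom c) b by exact: sY.
  apply: (is_derive_lineP b x Z.1 _).1; rewrite -ZX; apply: derivableP.
  by apply: Ck_derivable Cb _ _ _; exists z.1.
(* [frame_components] makes sense off [Q] as well, so its derivative in the direction [Z] is
   computed on a straight line, which need not stay in [Q]. *)
have CA k : Ck k setT (fun t : R^o => t *: Z.2 + z.2).
  exact: (Ck_line z.2 Z.2 (Ck_id k setT)).
have oU := open_unitmx openT (CA 0%N).
have DA : is_derive (0 : R^o) 1 (fun t : R^o => t *: Z.2 + z.2) Z.2.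
  apply: (is_derive_lineP id z.2 Z.2 _).1; exact: is_derive_id.
have U0 : ([set: R^o] `&` [set t | t *: Z.2 + z.2 \in unitmx]) 0.
  by split=> //=; rewrite scale0r add0r.
have uU (t : R^o) : ([set: R^o] `&` [set t | t *: Z.2 + z.2 \in unitmx]) t ->
  t *: Z.2 + z.2 \in unitmx by case.
have DV := is_derive_invmx oU (Ck_sub (fun _ _ => I) (CA 1%N)) uU U0 DA.
have := is_derive_mulmx DV Db; rewrite /= !scale0r !add0r.
rewrite [b x]/b /= /x coordK// vector_rep_at => DAb.
have [_ D] := (is_derive_lineP (frame_components c Y) (x, z.2) Z _).2 DAb.
by rewrite -/x D mulNmx mulmxDr mulmxN !mulmxA mulmxV// !mul1mx addrC.
Qed.

End Manifold.

(** * Smooth orthonormalization *)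

Section GramSchmidtAlgebra.
Context {R : realType} {n m : nat}.
(** One argument covers both distributions. With [c] true, [P] stands for the projection onto V,
    where F squares to -1 and each chosen vector e uses up F e as well; with [c] false, for the
    projection onto L, which F annihilates. *)
Variables (c : bool) (P F G : 'M[R]_n) (E : 'M[R]_(n, m)).
Hypotheses (symG : G^T = G) (GF : G *m F = - (F^T *m G)).
Hypotheses (PP : P *m P = P) (PF : P *m F = F *m P).
Hypothesis (FFP : if c then F *m F *m P = - P else F *m P = 0).
Hypotheses (PE : P *m E = E) (EGE : E^T *m G *m E = 1%:M).
Hypothesis (EGFE : E^T *m G *m F *m E = 0).

(* The columns of [E], and those of [F *m E] if c, are orthonormal; [residue]
   is the part of [P] orthogonal to all of them. *)
Definition residue : 'M[R]_n :=
  P - E *m (E^T *m G *m P) - F *m E *m ((F *m E)^T *m G *m P).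

Lemma trFEG : (F *m E)^T *m G = - (E^T *m G *m F).
Proof. by rewrite trmx_mul -[E^T *m G *m F]mulmxA GF mulmxN opprK mulmxA. Qed.

Lemma FEGE : (F *m E)^T *m G *m E = 0.
Proof. by rewrite trFEG mulNmx EGFE oppr0. Qed.

Lemma FE0 : ~~ c -> F *m E = 0.
Proof. by move: FFP; case: c => // FP0 _; rewrite -PE mulmxA FP0 mul0mx. Qed.

Lemma FEGFE : c -> (F *m E)^T *m G *m (F *m E) = 1%:M.
Proof.
move: FFP; case: c => // FP _.
have FFE : F *m (F *m E) = - E by rewrite -[in LHS]PE !mulmxA FP mulNmx PE.
by rewrite trFEG mulNmx -[_ *m F *m _]mulmxA FFE mulmxN opprK.
Qed.

Lemma mul_residue : P *m residue = residue.
Proof.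
by rewrite /residue !mulmxBr !mulmxA PP PE PF -[F *m P *m E]mulmxA PE.
Qed.

Lemma EG_residue : E^T *m G *m residue = 0.
Proof.
rewrite /residue !mulmxBr !mulmxA EGE EGFE !mul0mx subr0 mul1mx.
exact: subrr.
Qed.

Lemma FEG_residue : (F *m E)^T *m G *m residue = 0.
Proof.
have [ct|cf] := boolP c; last by rewrite FE0// trmx0 !mul0mx.
rewrite /residue !mulmxBr [_ *m (E *m _)]mulmxA FEGE mul0mx subr0.
by rewrite [_ *m (F *m E *m _)]mulmxA FEGFE// mul1mx subrr.
Qed.

(** If it vanished, [P] would be a sum of matrices factoring through the columns already chosen, and
    its rank would be at most their number. *)
Lemma residue_neq0 : (m + (if c then m else 0) < \rank P)%N -> residue != 0.
Proof.
apply: contraTneq => W0; rewrite -leqNgt.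
have -> : P = E *m (E^T *m G *m P) + F *m E *m ((F *m E)^T *m G *m P).
  by apply/eqP; rewrite -subr_eq0 opprD addrA; apply/eqP.
apply: leq_trans (mxrank_add _ _) _; apply: leq_add.
  exact: leq_trans (mxrankM_maxl _ _) (rank_leq_col _).
apply: leq_trans (mxrankM_maxl _ _) _.
have [ct|cf] := boolP c; first exact: rank_leq_col.
by rewrite FE0// mxrank0.
Qed.

Lemma extend_orthonormal (e : 'cV[R]_n) : P *m e = e ->
  E^T *m G *m e = 0 -> (F *m E)^T *m G *m e = 0 -> e^T *m G *m e = 1%:M ->
  let E' := row_mx e E in
  [/\ P *m E' = E', E'^T *m G *m E' = 1%:M & E'^T *m G *m F *m E' = 0].
Proof.
move=> Pe EGe FEGe eGe E'.
have eGE : e^T *m G *m E = 0.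
  by apply: trmx_inj; rewrite trmx0 !trmx_mul trmxK symG mulmxA.
have EGFe : E^T *m G *m F *m e = 0.
  by apply/eqP; rewrite -oppr_eq0 -mulNmx -trFEG FEGe.
have eGFE : e^T *m G *m F *m E = 0.
  apply: trmx_inj; rewrite trmx0 -[in LHS]mulmxA !trmx_mul trmxK symG.
  by rewrite -trmx_mul mulmxA.
(* A skew 1 x 1 matrix vanishes: F e is automatically orthogonal to e. *)
have eGFe : e^T *m G *m F *m e = 0.
  have : (e^T *m G *m F *m e)^T = - (e^T *m G *m F *m e).
    rewrite !trmx_mul trmxK symG -[e^T *m G *m F]mulmxA GF mulmxN mulNmx opprK.
    by rewrite !mulmxA.
  rewrite [X in X^T]mx11_scalar tr_scalar_mx -mx11_scalar => /eqP.
  by rewrite -subr_eq0 opprK -mulr2n -scaler_nat scaler_eq0 pnatr_eq0 => /eqP.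
rewrite /E' {E'}; split; first by rewrite mul_mx_row PE Pe.
- rewrite tr_row_mx mul_col_mx [LHS](mul_col_row (e^T *m G) (E^T *m G) e E) eGe eGE EGe EGE.
  by rewrite -scalar_mx_block.
- rewrite tr_row_mx 2!mul_col_mx [LHS](mul_col_row (_ *m F) (_ *m F) e E) eGFe eGFE EGFe EGFE.
  exact: block_mx0.
Qed.

End GramSchmidtAlgebra.

Section GramSchmidt.
Context {R : realType} {n : nat}.
Variables (O0 : set R^o) (F G : R^o -> 'M[R]_n).
Hypotheses (oO0 : open O0) (O00 : O0 0).
Hypotheses (sF : smooth_on O0 F) (sG : smooth_on O0 G).
Hypothesis symG : forall t, O0 t -> (G t)^T = G t.
Hypothesis posG : forall t (v : 'cV[R]_n), O0 t -> v != 0 -> 0 < (v^T *m G t *m v) ord0 ord0.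
Hypothesis GF : forall t, O0 t -> G t *m F t = - ((F t)^T *m G t).

(** Gram-Schmidt by induction on m: a column of the residue is normalized and adjoined. The rank
    bound at 0 guarantees a nonzero residue there. *)
Lemma local_orthonormal (c : bool) (P : R^o -> 'M[R]_n) (m : nat) :
  smooth_on O0 P -> (forall t, O0 t -> P t *m P t = P t) ->
  (forall t, O0 t -> P t *m F t = F t *m P t) ->
  (forall t, O0 t ->
     if c then F t *m F t *m P t = - P t else F t *m P t = 0) ->
  (m + (if c then m else 0) <= \rank (P 0%R))%N ->
  exists (O : set R^o) (E : R^o -> 'M[R]_(n, m)),
    [/\ open O, O 0, O `<=` O0, smooth_on O E & forall t, O t ->
      [/\ P t *m E t = E t, (E t)^T *m G t *m E t = 1%:M
        & (E t)^T *m G t *m F t *m E t = 0]].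
Proof.
move=> sP PP PF FFP; elim: m => [|m IHm] rkP.
  exists O0, (fun=> 0); split=> // [k|t Ot]; first exact: Ck_cst.
  by split; rewrite ?mulmx0//; apply/matrixP => -[].
have [|O [E [oO O0' OO0 sE hE]]] := IHm.
  by apply: leq_trans rkP; case: (c); rewrite ?addn0// leq_add.
pose W t := residue (P t) (F t) (G t) (E t).
have W0 : W 0 != 0.
  have [PE EGE EGFE] := hE 0 O0'.
  apply: (residue_neq0 _ (FFP 0 O00) PE).
  by apply: leq_trans rkP; case: (c); rewrite ?addn0// addSn addnS ltnS leqnSn.
(* The column index is fixed at t = 0; the neighbourhood is later shrunk to where the squared length
   [q] of that column stays positive, so that normalizing is smooth. *)
have [j Wj] : exists j, col j (W 0) != 0.
  apply/existsP; apply: contraNT W0 => /existsPn W0; apply/eqP/matrixP => i j.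
  by have /eqP/colP/(_ i) := negbNE (W0 j); rewrite !mxE.
have sW : smooth_on O W.
  move=> k; have CP := Ck_sub OO0 (sP k); have CF := Ck_sub OO0 (sF k).
  have CG := Ck_sub OO0 (sG k); have CE := sE k.
  rewrite /W /residue; do !(apply: Ck_add => //); rewrite -?/(_ - _).
  - apply: Ck_oppmx => //; do !(apply: Ck_mulmx => //); exact: Ck_trmx.
  - apply: Ck_oppmx => //; do !(apply: Ck_mulmx => //).
    by apply: Ck_trmx => //; exact: Ck_mulmx.
pose w t := col j (W t).
have wE t : w t = W t *m delta_mx j ord0 by rewrite /w colE.
have sw : smooth_on O w.
  move=> k; rewrite (_ : w = fun t => W t *m delta_mx j ord0); last exact/funext.
  by apply: Ck_mulmx => //; exact: Ck_cst.
pose q t := ((w t)^T *m G t *m w t) ord0 ord0.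
have sq : smooth_on O (q : R^o -> R).
  move=> k; have CG := Ck_sub OO0 (sG k).
  have : Ck k O (fun t => (w t)^T *m G t *m w t).
    by do !(apply: Ck_mulmx => //); exact: Ck_trmx.
  by move/CkmxP; exact.
pose O' := O `&` [set t | q t > 0].
have oO' : open O'.
  rewrite openE => t [Ot qt]; apply: filterI; first exact: open_nbhs_nbhs.
  have cq : {for t, continuous (q : R^o -> R)} := Ck_continuous (sq 0%N) Ot.
  apply: (cq [set x : R | 0 < x]).
  by apply: open_nbhs_nbhs; split=> //; exact: open_gt.
have O'O : O' `<=` O by exact: subIsetl.
pose e t := (Num.sqrt (q t))^-1 *: w t.
exists O', (fun t => row_mx (e t) (E t) : 'M[R]_(n, m.+1)); split=> //.
- split=> //=; rewrite /q; apply: posG => //.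
- exact: subset_trans OO0.
- move=> k; have /CkmxP-/(_ oO') CE := Ck_sub O'O (sE k).
  have : Ck k O' e.
    apply: Ck_scale => //; last exact: Ck_sub (sw k).
    have q0 t : O' t -> 0 < q t by case.
    have Cq := Ck_sub O'O (sq k).
    apply: Ck_inv => //; last exact: Ck_sqrt.
    by move=> t O't; rewrite gt_eqF// sqrtr_gt0 q0.
  move=> /CkmxP-/(_ oO') Ce; apply/CkmxP => // i l.
  case: (split_ordP (l : 'I_(1 + m))) => l' ->.
    rewrite (_ : (fun t => _) = fun t => e t i l'); first exact: Ce.
    by apply/funext => t; exact: row_mxEl.
  rewrite (_ : (fun t => _) = fun t => E t i l'); first exact: CE.
  by apply/funext => t; exact: row_mxEr.
- move=> t [Ot /= qt]; have O0t := OO0 _ Ot; have [PE EGE EGFE] := hE t Ot.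
  have [symt GFt PPt PFt FFPt] :=
    And5 (symG O0t) (GF O0t) (PP t O0t) (PF t O0t) (FFP t O0t).
  have Pw : P t *m w t = w t.
    by rewrite wE mulmxA (mul_residue _ _ PFt).
  have EGw : (E t)^T *m G t *m w t = 0.
    by rewrite wE mulmxA EG_residue// mul0mx.
  have FEGw : (F t *m E t)^T *m G t *m w t = 0.
    by rewrite wE mulmxA (FEG_residue GFt FFPt)// mul0mx.
  apply: (extend_orthonormal symt GFt PE EGE EGFE).
  + by rewrite -scalemxAr Pw.
  + by rewrite -scalemxAr EGw scaler0.
  + by rewrite -scalemxAr FEGw scaler0.
  + rewrite /e [X in X *m _ *m _]linearZ/= -!scalemxAl -scalemxAr scalerA.
    rewrite [_ *m _ *m _]mx11_scalar -/(q t) scale_scalar_mx -invfM -expr2.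
    by rewrite sqr_sqrtr ?mulVf ?gt_eqF// ltW.
Qed.
End GramSchmidt.

(** * The orthogonal complement of o(k) + u(n2) *)

Import Defs.

Section TraceForm.
Context {R : realType}.

Lemma trace_mul_tr m n (A : 'M[R]_(m, n)) :
  \tr (A *m A^T) = \sum_i \sum_j A i j ^+ 2.
Proof.
by apply: eq_bigr => i _; rewrite mxE; apply: eq_bigr => j _; rewrite mxE expr2.
Qed.

Lemma trace_mul_tr_ge0 m n (A : 'M[R]_(m, n)) : 0 <= \tr (A *m A^T).
Proof.
by rewrite trace_mul_tr; do 2![apply: sumr_ge0 => ? _]; exact: sqr_ge0.
Qed.

Lemma trace_mul_tr_eq0 m n (A : 'M[R]_(m, n)) : \tr (A *m A^T) = 0 -> A = 0.
Proof.
rewrite trace_mul_tr => /eqP; rewrite psumr_eq0; last first.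
  by move=> i _; apply: sumr_ge0 => j _; exact: sqr_ge0.
move=> /allP A0; apply/matrixP => i j; rewrite mxE.
have := A0 i (mem_index_enum i); rewrite implyTb psumr_eq0; last first.
  by move=> l _; exact: sqr_ge0.
by move=> /allP/(_ j (mem_index_enum j)); rewrite implyTb sqrf_eq0 => /eqP.
Qed.

End TraceForm.

Section FMatrix.
Context {R : realType} {k n2 : nat}.
Notation n := (k + (n2 + n2))%N.
Notation f := (@f_matrix R k n2).
Notation J := (block_mx 0 1%:M (- 1%:M) 0 : 'M[R]_(n2 + n2)).

Lemma f_matrixE : f = block_mx 0 0 0 J.
Proof. by []. Qed.

Lemma mulJJ : J *m J = - 1%:M.
Proof.
rewrite mulmx_block !(mul0mx, mulmx0, mul1mx, mulmx1, add0r, addr0).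
by rewrite scalar_mx_block opp_block_mx oppr0.
Qed.

Lemma mul_f_f : f *m f = block_mx 0 0 0 (- 1%:M).
Proof. by rewrite f_matrixE mulmx_block !(mul0mx, mulmx0, add0r, addr0) mulJJ. Qed.

(* A skew B orthogonal to o(k) + u(n2) is orthogonal to its own projection
   [T] to that algebra, whence T = 0. *)
Lemma h_orthogonal_block (Q : 'M[R]_k) Q12 Q21 (a b c d : 'M[R]_n2) :
  let B := block_mx Q Q12 Q21 (block_mx a b c d) in
  orthogonal_algebra B ->
  (forall C, h_algebra C -> - \tr (B *m C) = 0) ->
  [/\ Q = 0, d = - a & c = b].
Proof.
rewrite /orthogonal_algebra/=.
rewrite !tr_block_mx !opp_block_mx => skB orthB.
have [skQ _ _ /eq_block_mx[ska skc skb skd]] := eq_block_mx skB.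
have skad : (a + d)^T = - (a + d) by rewrite linearD/= ska skd opprD.
have sybc : (b - c)^T = b - c by rewrite linearB/= skb skc opprK addrC.
(* In the u(n2) block the factor 1/2 of the projection is dropped, since only its vanishing is at
   stake. *)
pose T : 'M[R]_n :=
  block_mx Q 0 0 (block_mx (a + d) (b - c) (- (b - c)) (a + d)).
have hT : h_algebra T.
  split; last by exists Q, (a + d), (b - c).
  rewrite /orthogonal_algebra/= /T !tr_block_mx !opp_block_mx.
  by rewrite !trmx0 skQ skad (linearN _ (b - c))/= sybc !opprK ?oppr0.
have trT : \tr (Q *m Q^T) + (\tr ((a + d) *m (a + d)^T) +
                             \tr ((b - c) *m (b - c)^T)) = 0.
  have <- := orthB T hT; rewrite skQ skad sybc /T !mulmx_block !mxtrace_block.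
  rewrite !mulmx0 !add0r !addr0 !mxtrace_block !mulmxN !mxtraceD.
  rewrite (mulmxDl a d (a + d)) (mulmxBl b c (b - c)) !mxtraceD.
  rewrite !(linearN (@mxtrace _ _))/= !mxtraceD.
 
  ring.
have Q0 := trace_mul_tr_ge0 Q; have ad0 := trace_mul_tr_ge0 (a + d).
have bc0 := trace_mul_tr_ge0 (b - c).
move/eqP: trT; rewrite paddr_eq0 ?addr_ge0// paddr_eq0// => /and3P[].
move=> /eqP/trace_mul_tr_eq0 -> /eqP/trace_mul_tr_eq0/eqP + /eqP/trace_mul_tr_eq0/eqP.
by rewrite addrC addr_eq0 subr_eq0 => /eqP -> /eqP ->.
Qed.

(** The relations d = - a and c = b say that the lower right block N anticommutes with the complex
    structure J; as J^2 = - 1, this amounts to J N J = N. *)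
Lemma h_orthogonalP (B : 'M[R]_n) : orthogonal_algebra B ->
  (forall C, h_algebra C -> - \tr (B *m C) = 0) ->
  (f *m f + 1%:M) *m B *m (f *m f + 1%:M) = 0 /\
  f *m f *m B *m (f *m f) = f *m B *m f.
Proof.
rewrite -(submxK B) -(submxK (drsubmx B)).
move: (ulsubmx B) (ursubmx B) (dlsubmx B) (drsubmx B) => Q Q12 Q21 N.
move: (ulsubmx N) (ursubmx N) (dlsubmx N) (drsubmx N) => a b c d.
move=> skB /(h_orthogonal_block skB)[-> -> ->].
rewrite mul_f_f (scalar_mx_block k (n2 + n2)) add_block_mx !addr0 add0r addNr.
rewrite !mulmx_block !(mul0mx, mulmx0, mul1mx, mulmx1, addr0, add0r).
rewrite !(mulNmx, mulmxN, mul1mx, mulmx1, oppr0, opprK).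
split; first by rewrite block_mx0.
by rewrite mulmx_block !mulmx0 !mulmx1 !mulmxN !mulmx1 !opprK !add0r !addr0.
Qed.

End FMatrix.

(** * Curves of orthogonal matrices *)

Import Defs.

Section Cayley.
Context {R : realType} {n : nat}.
Variable A : 'M[R]_n.
Hypothesis skA : A^T = - A.

(** For skew A the matrices [P t] and [N t] are transposes of each other and commute, which makes
    N^-1 P orthogonal. Each contributes A / 2 to its derivative at 0, hence the factor 1/2. *)
Let P (t : R^o) : 'M[R]_n := (2^-1 * t) *: A + 1%:M.
Let N (t : R^o) : 'M[R]_n := - ((2^-1 * t) *: A) + 1%:M.

Let trN t : (N t)^T = P t.
Proof. by rewrite /N linearD linearN linearZ/= skA scalerN opprK trmx1. Qed.

Let NP t : N t *m P t = P t *m N t.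
Proof.
rewrite /N /P !mulmxDl !mulmxDr !mulmx1 !mul1mx mulNmx mulmxN.
by rewrite -!addrA; congr (_ + _); rewrite addrCA.
Qed.

Let comm_invN t (f : 'M[R]_n) : N t \in unitmx -> A *m f = f *m A ->
  invmx (N t) *m f = f *m invmx (N t).
Proof.
move=> uN Af; apply: (can_inj (mulKmx uN)).
rewrite mulKVmx// mulmxA.
have -> : N t *m f = f *m N t.
  by rewrite /N mulmxDl mulmxDr mul1mx mulmx1 mulNmx mulmxN -scalemxAl -scalemxAr Af.
by rewrite mulmxK.
Qed.

Let comm_P t (f : 'M[R]_n) : A *m f = f *m A -> P t *m f = f *m P t.
Proof.
by move=> Af; rewrite /P mulmxDl mulmxDr mul1mx mulmx1 -scalemxAl -scalemxAr Af.
Qed.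

(* The Cayley transform of t A / 2. *)
Lemma local_orthogonal_curve : exists (O : set R^o) (c : R^o -> 'M[R]_n),
  [/\ open O, O 0, smooth_on O c, c 0 = 1%:M & 'D_1 c 0 = A] /\
  forall t, O t -> (c t)^T *m c t = 1%:M /\
    forall f, A *m f = f *m A -> c t *m f = f *m c t.
Proof.
pose O := [set: R^o] `&` [set t | N t \in unitmx].
have P0 : P 0 = 1%:M by rewrite /P mulr0 scale0r add0r.
have N0 : N 0 = 1%:M by rewrite /N mulr0 scale0r oppr0 add0r.
have CP k U : open U -> Ck k U P.
  move=> oU; apply: Ck_add => //; last exact: Ck_cst.
  apply: Ck_scale => //; last exact: Ck_cst.
  by apply: (@Ck_mul R R^o) => //; [exact: Ck_cst|exact: Ck_id].
have CN k U : open U -> Ck k U N.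
  move=> oU; apply: Ck_add => //; last exact: Ck_cst.
  apply: Ck_oppmx => //; apply: Ck_scale => //; last exact: Ck_cst.
  by apply: (@Ck_mul R R^o) => //; [exact: Ck_cst|exact: Ck_id].
have oO : open O by apply: open_unitmx; [exact: openT|exact/CN/openT].
have O0 : O 0 by split; rewrite //= N0 unitmx1.
have uN t : O t -> N t \in unitmx by case.
exists O, (fun t => invmx (N t) *m P t); split; first split=> //.
- move=> k; apply: Ck_mulmx => //; last exact: CP.
  by apply: Ck_invmx => //; exact: CN.
- by rewrite N0 P0 mulmx1 invmx1.
- have dl : is_derive (0 : R^o) 1 (fun t : R^o => t *: (2^-1 *: A) + 1%:M) (2^-1 *: A).
    by apply: (is_derive_lineP id 1%:M (2^-1 *: A) _).1; exact: is_derive_id.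
  have dP : is_derive (0 : R^o) 1 P (2^-1 *: A).
    rewrite (_ : P = fun t => t *: (2^-1 *: A) + 1%:M)//.
    by apply/funext => t; rewrite /P scalerA mulrC.
  have dl' : is_derive (0 : R^o) 1 (fun t : R^o => t *: (- (2^-1 *: A)) + 1%:M)
      (- (2^-1 *: A)).
    by apply: (is_derive_lineP id 1%:M (- (2^-1 *: A)) _).1; exact: is_derive_id.
  have dN : is_derive (0 : R^o) 1 N (- (2^-1 *: A)).
    rewrite (_ : N = fun t => t *: (- (2^-1 *: A)) + 1%:M)//.
    by apply/funext => t; rewrite /N scalerN scalerA mulrC.
  have [_ ->] := is_derive_mulmx (is_derive_invmx oO (CN 1%N O oO) uN O0 dN) dP.
  rewrite N0 P0 invmx1 !mulmx1 !mul1mx opprK -scalerDl.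
  by have -> : 2^-1 + 2^-1 = 1 :> R; [rewrite [RHS]splitr mul1r|rewrite scale1r].
- move=> t /uN Nt; have Pt : P t \in unitmx by rewrite -trN unitmx_tr.
  split=> [|f Af]; last first.
    by rewrite -mulmxA (comm_P t Af) mulmxA (comm_invN Nt Af) mulmxA.
  have trP : (P t)^T = N t by rewrite -trN trmxK.
  rewrite trmx_mul trmx_inv trN trP.
  rewrite mulmxA -[N t *m _ *m _]mulmxA -[N t *m (_ *m _) *m _]mulmxA.
  have -> : invmx (P t) *m invmx (N t) = invmx (N t) *m invmx (P t).
    apply: (can_inj (mulKmx Nt)); rewrite mulKVmx//.
    apply: (can_inj (mulKmx Pt)); rewrite mulmxV// !mulmxA -NP.
    by rewrite -[N t *m _ *m _]mulmxA mulmxV// mulmx1 mulmxV.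
  by rewrite -[_ *m _ *m P t]mulmxA mulVmx// mulmx1 mulmxV.
Qed.

End Cayley.

(** * Local adapted frames *)

Import Defs.

Section FAlgebra.
Context {R : realType} {n : nat}.
Variable F : 'M[R]_n.
Hypothesis F3 : F *m F *m F + F = 0.
Notation P1 := (F *m F + 1%:M).
Notation P2 := (- (F *m F)).

Lemma FFF : F *m F *m F = - F.
Proof. by apply/eqP; rewrite -addr_eq0 F3. Qed.

Lemma mul_F_P1 : F *m P1 = 0.
Proof. by rewrite mulmxDr mulmxA mulmx1 F3. Qed.

Lemma mul_P1_F : P1 *m F = 0.
Proof. by rewrite mulmxDl mul1mx F3. Qed.

Lemma mul_F_P2 : F *m P2 = F.
Proof. by rewrite mulmxN mulmxA FFF opprK. Qed.

Lemma mul_P2_F : P2 *m F = F.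
Proof. by rewrite mulNmx FFF opprK. Qed.

Lemma mul_FF_P2 : F *m F *m P2 = - P2.
Proof. by rewrite -mulmxA mul_F_P2 opprK. Qed.

Lemma mul_P1_P1 : P1 *m P1 = P1.
Proof. by rewrite mulmxDl mul1mx -mulmxA mul_F_P1 mulmx0 add0r. Qed.

Lemma mul_P2_P2 : P2 *m P2 = P2.
Proof. by rewrite {1}mulNmx -mulmxA mul_F_P2. Qed.

Lemma mul_P1_P2 : P1 *m P2 = 0.
Proof. by rewrite mulmxN mulmxA mul_P1_F mul0mx oppr0. Qed.

Lemma mul_P2_P1 : P2 *m P1 = 0.
Proof. by rewrite mulNmx -mulmxA mul_F_P1 mulmx0 oppr0. Qed.

Lemma P1_add_P2 : P1 + P2 = 1%:M.
Proof. by rewrite addrAC subrr add0r. Qed.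

Lemma rank_P2 : \rank P2 = \rank F.
Proof.
apply/eqP; rewrite eqn_leq; apply/andP; split.
  by rewrite -mulNmx mxrankM_maxr.
by rewrite -{1}mul_P2_F mxrankM_maxl.
Qed.

Lemma rank_P1 : (n <= \rank P1 + \rank F)%N.
Proof.
by have := mxrank_add P1 P2; rewrite P1_add_P2 mxrank1 rank_P2.
Qed.

Variable G : 'M[R]_n.
Hypothesis GF : G *m F = - (F^T *m G).

Lemma mul_trP1_G : P1^T *m G = G *m P1.
Proof.
rewrite linearD/= trmx1 mulmxDl mulmxDr mul1mx mulmx1 trmx_mul; congr (_ + _).
by rewrite mulmxA GF mulNmx -[_ *m G *m F]mulmxA GF mulmxN opprK mulmxA.
Qed.

End FAlgebra.

(** The minus sign in the last block is dictated by [f_matrix], which sends the first half of the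
    V-basis to minus the second half. Orthogonality of L to E and F E holds because the projection
    onto L is self-adjoint for g. *)
Lemma frame_blocks {R : realType} {k n2 : nat} (f g : 'M[R]_(k + (n2 + n2)))
    (L : 'M[R]_(k + (n2 + n2), k)) (E : 'M[R]_(k + (n2 + n2), n2)) :
  f *m f *m f + f = 0 -> g^T = g -> g *m f = - (f^T *m g) ->
  (f *m f + 1%:M) *m L = L -> L^T *m g *m L = 1%:M ->
  - (f *m f) *m E = E -> E^T *m g *m E = 1%:M -> E^T *m g *m f *m E = 0 ->
  let u := row_mx L (row_mx E (- (f *m E))) in
  u^T *m g *m u = 1%:M /\ f *m u = u *m f_matrix.
Proof.
move=> F3t sGt GFt PL LGL PE EGE EGFE u.
have FL : f *m L = 0 by rewrite -PL mulmxA mul_F_P1// mul0mx.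
have FFE : f *m (f *m E) = - E by rewrite -[in RHS]PE !mulNmx opprK mulmxA.
have LGP : L^T *m g = L^T *m g *m (f *m f + 1%:M).
  by rewrite -[RHS]mulmxA -mul_trP1_G// mulmxA -trmx_mul PL.
have LGE : L^T *m g *m E = 0.
  by rewrite LGP -PE -mulmxA [(_ + _) *m _]mulmxA mul_P1_P2// mul0mx mulmx0.
have LGFE : L^T *m g *m (f *m E) = 0.
  by rewrite LGP -mulmxA [(_ + _) *m _]mulmxA mul_P1_F// mul0mx mulmx0.
have EGL : E^T *m g *m L = 0.
  by apply: trmx_inj; rewrite trmx0 !trmx_mul trmxK sGt mulmxA.
have EGFE' : E^T *m g *m (f *m E) = 0 by rewrite mulmxA.
have FEGL : (f *m E)^T *m g *m L = 0.
  by apply: trmx_inj; rewrite trmx0 !trmx_mul !trmxK sGt [L^T *m _]mulmxA.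
have FEGE' := FEGE GFt EGFE.
have FEGFE' := FEGFE (c := true) GFt (mul_FF_P2 F3t) PE EGE isT.
have LGX : L^T *m g *m row_mx E (- (f *m E)) = 0.
  by rewrite mul_mx_row mulmxN LGE LGFE oppr0 row_mx0.
have XGL : (row_mx E (- (f *m E)))^T *m g *m L = 0.
  by apply: trmx_inj; rewrite trmx0 !trmx_mul trmxK sGt mulmxA.
have XGX : (row_mx E (- (f *m E)))^T *m g *m row_mx E (- (f *m E)) = 1%:M.
  rewrite tr_row_mx mul_col_mx [LHS](mul_col_row (E^T *m g) _ E (- (f *m E))).
  have -> : (- (f *m E))^T = - (f *m E)^T by exact: linearN.
  rewrite !mulNmx !mulmxN opprK EGE EGFE' FEGE' FEGFE' oppr0.
  by rewrite -scalar_mx_block.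
split.
  rewrite /u tr_row_mx mul_col_mx [LHS](mul_col_row (L^T *m g) _ L _).
  by rewrite LGL LGX XGL XGX -scalar_mx_block.
rewrite /u [LHS]mul_mx_row FL mul_mx_row mulmxN FFE opprK.
rewrite /f_matrix mul_row_block mul_row_block !mulmx0 !mulmxN !mulmx1 opprK.
by rewrite !add0r !addr0.
Qed.

Section LocalFrame.
Context {R : realType} {k n2 : nat}.
Notation n := (k + (n2 + n2))%N.
Variables (O0 : set R^o) (F G : R^o -> 'M[R]_n).
Hypotheses (oO0 : open O0) (O00 : O0 0).
Hypotheses (sF : smooth_on O0 F) (sG : smooth_on O0 G).
Hypothesis symG : forall t, O0 t -> (G t)^T = G t.
Hypothesis posG : forall t (v : 'cV[R]_n), O0 t -> v != 0 ->
  0 < (v^T *m G t *m v) ord0 ord0.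
Hypothesis GF : forall t, O0 t -> G t *m F t = - ((F t)^T *m G t).
Hypothesis F3 : forall t, O0 t -> F t *m F t *m F t + F t = 0.
Hypothesis rkF : \rank (F 0) = (2 * n2)%N.

(** Orthonormalization is run twice: for k vectors in L, whose rank is at least n - 2 n2 = k, and
    for n2 vectors in V, whose images under F supply the other half. *)
Lemma local_adapted_frame : exists (O : set R^o) (u : R^o -> 'M[R]_n),
  [/\ open O, O 0, O `<=` O0, smooth_on O u & forall t, O t ->
    (u t)^T *m G t *m u t = 1%:M /\ F t *m u t = u t *m f_matrix].
Proof.
have sFF : smooth_on O0 (fun t => F t *m F t) by move=> l; exact: Ck_mulmx.
have [|||||O1 [L [oO1 O10 O1O0 sL hL]]] :=
  local_orthonormal (c := false) (P := fun t => F t *m F t + 1%:M) (m := k)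
    oO0 O00 sF sG symG posG GF.
- by move=> l; apply: Ck_add => //; exact: Ck_cst.
- by move=> t /F3; exact: mul_P1_P1.
- by move=> t /F3 F3t; rewrite mul_F_P1// mul_P1_F.
- by move=> t /F3; exact: mul_F_P1.
- have := rank_P1 (F3 O00); rewrite rkF mul2n -addnn leq_add2r addn0.
  exact.
have [|||||O2 [E [oO2 O20 O2O0 sE hE]]] :=
  local_orthonormal (c := true) (P := fun t => - (F t *m F t)) (m := n2)
    oO0 O00 sF sG symG posG GF.
- by move=> l; apply: Ck_oppmx.
- by move=> t /F3; exact: mul_P2_P2.
- by move=> t /F3 F3t; rewrite mul_F_P2// mul_P2_F.
- by move=> t /F3; exact: mul_FF_P2.
- by rewrite rank_P2 ?rkF ?mul2n ?addnn//; exact: F3.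
pose O := O1 `&` O2; have oO : open O by exact: openI.
exists O, (fun t => row_mx (L t) (row_mx (E t) (- (F t *m E t)))).
have OO0 : O `<=` O0 by move=> t [/O1O0].
split=> // [l|t [/hL[PL LGL LGFL] /[dup] /O2O0 O0t /hE[PE EGE EGFE]]].
  have CL := Ck_sub (@subIsetl _ O1 O2) (sL l).
  have CE := Ck_sub (@subIsetr _ O1 O2) (sE l).
  have CF := Ck_sub OO0 (sF l).
  have CFE : Ck l O (fun t => - (F t *m E t)).
    by apply: Ck_oppmx => //; exact: Ck_mulmx.
  apply/CkmxP => // i j; case: (split_ordP j) => j' ->.
    under eq_fun do rewrite row_mxEl.
    by have /CkmxP := CL; exact.
  under eq_fun do rewrite row_mxEr.
  case: (split_ordP j') => j'' ->.
    under eq_fun do rewrite row_mxEl.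
    by have /CkmxP := CE; exact.
  under eq_fun do rewrite row_mxEr.
  by have /CkmxP := CFE; exact.
exact: frame_blocks (F3 O0t) (symG O0t) (GF O0t) PL LGL PE EGE EGFE.
Qed.

End LocalFrame.

(** * Riemannian f-structures *)

Import Defs.

Section RiemannianFStructure.
Context {R : realType} {k n2 : nat} {M : manifold R (k + (n2 + n2))}.
Notation n := (k + (n2 + n2))%N.
Variables (F : endo_field M) (g : bilinear_field M).
Hypothesis Fg : riemannian_f_structure F g (2 * n2).

Lemma f_structure3 p : F p *m F p *m F p + F p = 0.
Proof. by case: Fg => -[_ _ + _]. Qed.

Lemma bilinear_mx0 (A : 'M[R]_n) :
  (forall v w : 'cV[R]_n, (v^T *m A *m w) ord0 ord0 = 0) -> A = 0.
Proof.
move=> A0; apply/matrixP => i j; have := A0 (delta_mx i ord0) (delta_mx j ord0).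
by rewrite trmx_delta -rowE -colE !mxE.
Qed.

(** On V an isometry with square -1 is skew; the remaining blocks vanish because F annihilates L and
    L is orthogonal to V. *)
Lemma metric_skew p : g p *m F p = - ((F p)^T *m g p).
Proof.
have F3 := f_structure3 p.
case: Fg => _ [_ symg _] VL isoV.
pose P1 := F p *m F p + 1%:M; pose P2 := - (F p *m F p).
have ortho : P2^T *m g p *m P1 = 0.
  apply: bilinear_mx0 => v w.
  have /VL/(_ (P1 *m w)) : distV F p (P2 *m v) by exists v.
  rewrite /inner trmx_mul !mulmxA => ->//.
  by exists w.
have iso : P2^T *m (F p)^T *m g p *m (F p *m P2) = P2^T *m g p *m P2.
  apply/eqP; rewrite -subr_eq0; apply/eqP; apply: bilinear_mx0 => v w.
  have sub00 (A B : 'M[R]_1) : (A - B) ord0 ord0 = A ord0 ord0 - B ord0 ord0.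
    by rewrite !mxE.
  have := isoV p (P2 *m v) (P2 *m w).
  rewrite /inner !trmx_mul mulmxBr mulmxBl !mulmxA sub00 => ->; rewrite ?subrr//.
    by exists v.
  by exists w.
have ortho' : P1^T *m g p *m P2 = 0.
  by apply: trmx_inj; rewrite trmx0 !trmx_mul trmxK symg mulmxA.
have FGP1 : (F p)^T *m g p *m P1 = 0.
  by rewrite -(mul_P2_F F3) trmx_mul -[X in X *m P1]mulmxA -mulmxA ortho mulmx0.
have FGP2 : (F p)^T *m g p = (F p)^T *m g p *m P2.
  by rewrite -[LHS]mulmx1 -(P1_add_P2 (F p)) mulmxDr FGP1 add0r.
have e1 : P1^T *m g p *m F p = 0.
  by rewrite -[X in _ *m X](mul_P2_F F3) mulmxA ortho' mul0mx.
have e2 : g p *m F p = P2^T *m g p *m F p.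
  rewrite -[in LHS](mul1mx (g p)) -[1%:M]trmx1 -(P1_add_P2 (F p)).
  by rewrite [X in X *m _ *m _]linearD/= !mulmxDl e1 add0r.
have e3 : P2^T *m g p *m F p = P2^T *m g p *m P2 *m F p.
  by rewrite -[RHS]mulmxA mul_P2_F.
rewrite e2 e3 -iso -trmx_mul mul_F_P2// -mulmxA.
by rewrite [in RHS]FGP2 mulmxN opprK.
Qed.

Section AtPoint.
Variables (c : chart M) (q : M).
Hypothesis cq : dom c q.
Notation F' := (endo_rep c F q).
Notation g' := (bilinear_rep c g q).
Let J := chart_jacobian c (chart_at q) q.
Let J' := chart_jacobian (chart_at q) c q.

Let JJ' : J *m J' = 1%:M.
Proof. by apply: chart_jacobian_inv => //; exact: chart_atP. Qed.

Let J'J : J' *m J = 1%:M.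
Proof. by apply: chart_jacobian_inv => //; exact: chart_atP. Qed.

Lemma endo_rep_f3 : F' *m F' *m F' + F' = 0.
Proof.
rewrite -!endo_rep_mul// -endo_rep_add /endo_rep f_structure3.
by rewrite mulmx0 mul0mx.
Qed.

Lemma bilinear_rep_sym : g'^T = g'.
Proof.
by case: Fg => _ [_ symg _] _ _; rewrite /bilinear_rep !trmx_mul trmxK symg mulmxA.
Qed.

Lemma bilinear_rep_pos (v : 'cV[R]_n) : v != 0 ->
  0 < (v^T *m g' *m v) ord0 ord0.
Proof.
case: Fg => _ [_ _ posg] _ _ v0; rewrite /bilinear_rep !mulmxA -trmx_mul -mulmxA.
apply: (posg q (J *m v)); apply: contra_neq v0 => Jv.
by rewrite -[v]mul1mx -J'J -mulmxA Jv mulmx0.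
Qed.

Lemma bilinear_rep_skew : g' *m F' = - (F'^T *m g').
Proof.
rewrite /bilinear_rep /endo_rep -/J -/J' !trmx_mul.
rewrite -!mulmxA [J *m (J' *m _)]mulmxA JJ' mul1mx.
have trJ : J'^T *m J^T = 1%:M by rewrite -trmx_mul JJ' trmx1.
rewrite (mulmxA J'^T J^T) trJ mul1mx.
by rewrite [g q *m (_ *m J)]mulmxA metric_skew mulNmx mulmxN !mulmxA.
Qed.

Lemma orthonormal_in_chart (u : 'M[R]_n) :
  orthonormal_frames g (q, J *m u) <-> u^T *m g' *m u = 1%:M.
Proof.
rewrite /orthonormal_frames/= /bilinear_rep -/J trmx_mul !mulmxA.
by split.
Qed.

Lemma f_frame_in_chart (u : 'M[R]_n) :
  F' *m u = u *m f_matrix -> F q *m (J *m u) = J *m u *m f_matrix.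
Proof.
move=> Fu; rewrite -[J *m u *m _]mulmxA -Fu /endo_rep -/J -/J' !mulmxA.
by rewrite JJ' mul1mx.
Qed.

End AtPoint.

(** The conditions on L and V come for free: z intertwines F^2 with the square of [f_matrix], which
    is 0 on the first k basis vectors and -1 on the others. *)
Lemma adapted_framesP (z : frame M) : orthonormal_frames g z ->
  F z.1 *m z.2 = z.2 *m f_matrix -> adapted_frames F g z.
Proof.
move=> oz Fz.
have FFz : F z.1 *m F z.1 *m z.2 = z.2 *m (f_matrix *m f_matrix).
  by rewrite -mulmxA Fz mulmxA Fz mulmxA.
split=> // [i|j].
  exists (col (lshift (n2 + n2) i) z.2) => //.
  rewrite /pi1 mulmxDl mul1mx colE mulmxA FFz -mulmxA -colE mul_f_f.
  have -> : col (lshift (n2 + n2) i) (block_mx 0 0 0 (- 1%:M) : 'M[R]_n) = 0.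
    by rewrite block_mxEh colKl col_mx0; apply/colP => a; rewrite !mxE.
  by rewrite mulmx0 add0r.
exists (col (rshift k j) z.2) => //.
rewrite /pi2 mulNmx colE mulmxA FFz -mulmxA mul_f_f -[block_mx _ _ _ _ *m _]colE.
have -> : col (rshift k j) (block_mx 0 0 0 (- 1%:M) : 'M[R]_n) =
    - delta_mx (rshift k j) 0.
  rewrite block_mxEh colKr; apply/colP => a; rewrite !mxE.
  case: (split_ordP a) => b ->; rewrite ?col_mxEu ?col_mxEd !mxE.
    by rewrite eq_lrshift oppr0.
  by rewrite eq_rshift andbT.
by rewrite mulmxN opprK.
Qed.

Lemma h_algebra_comm (C : 'M[R]_n) : h_algebra C ->
  C *m f_matrix = f_matrix *m C.
Proof.
move=> [_ [c [A [B ->]]]]; rewrite /f_matrix !mulmx_block.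
by rewrite !(mul0mx, mulmx0, mul1mx, mulmx1, addr0, add0r, mulNmx, mulmxN).
Qed.

(** Definiteness of the trace form on skew matrices. It replaces linearity of [omegabar]: once the
    h-component A has been subtracted, any h-component of the remainder is zero. *)
Lemma h_component_unique (W A B : 'M[R]_n) :
  h_component h_algebra W A -> h_component h_algebra (W - A) B -> B = 0.
Proof.
move=> [_ WA] [hB WAB]; apply: trace_mul_tr_eq0.
have skB : B^T = - B by case: hB.
have := WAB B hB; rewrite mulmxBl linearB/= opprB => /eqP.
have /eqP := WA B hB; rewrite oppr_eq0 => /eqP ->; rewrite subr0 => /eqP BB.
by rewrite skB mulmxN linearN/= BB oppr0.
Qed.

Lemma tangent_sub (Q Q' : set (frame M)) z Z :
  Q `<=` Q' -> tangent Q z Z -> tangent Q' z Z.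
Proof.
move=> sQ [D [c [oD Qc sc c0 vc]]]; exists D, c; split=> // t /Qc.
exact: sQ.
Qed.

(** Adding a vertical vector to a velocity is realized by rotating the curve of frames along a
    Cayley curve. Letting the hypothesis assume that c commutes with everything A commutes with is
    what makes it usable for P(H), when A commutes with [f_matrix]. *)
Lemma tangent_rotate (Q : set (frame M)) p v (O : set R^o) u (A : 'M[R]_n) :
  open O -> O 0 -> O `<=` line_domain p v -> smooth_on O u -> A^T = - A ->
  (forall t (c : 'M[R]_n), O t -> c^T *m c = 1%:M ->
     (forall f, A *m f = f *m A -> c *m f = f *m c) ->
     Q (line_frame p v (fun=> u t *m c) t)) ->
  tangent Q (p, u 0) (v, 'D_1 u 0 + u 0 *m A).
Proof.
move=> oO O0 OD su skA Qu.
have [Oc [c [[oOc Oc0 sc c0 dc] cA]]] := local_orthogonal_curve skA.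
have oO' : open (O `&` Oc) by exact: openI.
have su' : smooth_on (O `&` Oc) (fun t => u t *m c t).
  move=> l; apply: Ck_mulmx => //.
    by apply: Ck_sub (su l); exact: subIsetl.
  by apply: Ck_sub (sc l); exact: subIsetr.
have := @tangent_line _ _ _ Q p v _ _ oO' (conj O0 Oc0) _ su'.
rewrite c0 mulmx1.
have du := derivableP (@Ck_derivable _ _ _ _ _ _ (su 1%N) 1 _ O0).
have dc' := derivableP (@Ck_derivable _ _ _ _ _ _ (sc 1%N) 1 _ Oc0).
have [_ ->] := is_derive_mulmx du dc'; rewrite c0 mulmx1 dc; apply.
  by move=> t [/OD].
by move=> t [Ot /cA[cc cf]]; exact: Qu.
Qed.

End RiemannianFStructure.

(** * Horizontal lifts *)

Import Defs.

Section Canonical.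
Context {R : realType} {k n2 : nat} {M : manifold R (k + (n2 + n2))}.
Notation n := (k + (n2 + n2))%N.
Variables (F : endo_field M) (g : bilinear_field M).
Variables (nabla nablabar : covariant_derivative M).
Hypothesis Fg : riemannian_f_structure F g (2 * n2).
Hypothesis canon : canonical_connection_f F g nabla nablabar.
Notation f := (@f_matrix R k n2).
Notation P := (adapted_frames F g).

Lemma smooth_endo_line A (p : M) v : smooth_endo A ->
  smooth_on (line_domain p v)
    (fun t => endo_rep (chart_at p) A (line_point p v t)).
Proof. by move=> sA l; exact: (Ck_line _ _ (sA (chart_at p) l)). Qed.

(* A frame z at p, a tangent (v, B) to P(H) at z that is horizontal for the
   canonical connection, and its connection matrix W for the Levi-Civita one. *)
Lemma horizontal_lift (p : M) (v : 'cV[R]_n) :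
  exists omega omegabar (z B W : 'M[R]_n),
  [/\ covariant_derivative_of (orthonormal_frames g) omega nabla,
      covariant_derivative_of P omegabar nablabar,
      P (p, z) & orthogonal_algebra W] /\
  [/\ tangent P (p, z) (v, B), omegabar (p, z) (v, B) = 0,
      tangent (orthonormal_frames g) (p, z) (v, B - z *m W),
      omega (p, z) (v, B - z *m W) = 0 &
      forall C, h_algebra C -> - \tr (W *m C) = 0] /\
  'D_v (endo_rep (chart_at p) F \o param (chart_at p)) (coord (chart_at p) p)
    *m z + F p *m B = B *m f.
Proof.
have [omega [omegabar [cform cov hcomp covbar]]] := canon.
have [[sF _ _ rkF] [sg _ _] _ _] := Fg.
pose c0 := chart_at p; pose D := line_domain p v.
have oD : open D by exact: line_domain_open.
have D0 : D 0 by exact: line_domain0.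
have Dc t : D t -> dom c0 (line_point p v t) by exact: line_point_dom.
pose Fl t := endo_rep c0 F (line_point p v t).
pose gl t := bilinear_rep c0 g (line_point p v t).
have sFl : smooth_on D Fl by exact: smooth_endo_line.
have [||||||U [u [oU U0 UD su hu]]] :=
  @local_adapted_frame R k n2 D Fl gl oD D0 sFl.
- by move=> l; exact: (Ck_line _ _ (sg (chart_at p) l)).
- by move=> t _; exact: (bilinear_rep_sym Fg).
- by move=> t w /Dc ct; exact: (bilinear_rep_pos Fg ct).
- by move=> t /Dc; exact: (bilinear_rep_skew Fg).
- by move=> t /Dc; exact: (endo_rep_f3 Fg).
- by rewrite /Fl line_point0 endo_rep_at.
have PO : P `<=` orthonormal_frames g by move=> z [].
have rotated t (a : 'M[R]_n) : U t -> a^T *m a = 1%:M ->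
    orthonormal_frames g (line_frame p v (fun=> u t *m a) t).
  move=> Ut aa; have [uu _] := hu t Ut.
  apply/orthonormal_in_chart.
  have -> : (u t *m a)^T *m gl t *m (u t *m a) =
      a^T *m ((u t)^T *m gl t *m u t) *m a by rewrite trmx_mul !mulmxA.
  by rewrite uu mulmx1.
have adapted t (a : 'M[R]_n) : U t -> a^T *m a = 1%:M -> a *m f = f *m a ->
    P (line_frame p v (fun=> u t *m a) t).
  move=> Ut aa af; have [_ Fu] := hu t Ut.
  apply: adapted_framesP; first exact: rotated.
  apply: (f_frame_in_chart (Dc t (UD t Ut))).
  by rewrite mulmxA Fu -!mulmxA af.
have Pu t : U t -> P (line_frame p v u t).
  move=> Ut; have := adapted t 1%:M Ut; rewrite trmx1 !mulmx1 !mul1mx.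
  by apply.
pose z := u 0.
have Pz : P (p, z) by have := Pu 0 U0; rewrite line_frame0.
have tP : tangent P (p, z) (v, 'D_1 u 0) by exact: tangent_line su Pu.
pose A := omegabar (p, z) (v, 'D_1 u 0).
have hA : h_component h_algebra (omega (p, z) (v, 'D_1 u 0)) A by exact: hcomp.
have [[skA _] _] := hA.
(* Linearity of [omega] is given for tangent vectors only, so a vertical vector must first be
   exhibited as a velocity: the base point rests (v = 0) while the frame rotates. *)
have vertical C : C^T = - C -> tangent (orthonormal_frames g) (p, z) (0, z *m C).
  move=> skC; have := @tangent_rotate _ _ _ _ (orthonormal_frames g) p 0 setT (fun=> z) C openT I.
  rewrite derive_cst add0r; apply=> //.
  - by move=> t _; rewrite /line_domain/= scaler0 add0r; exists p => //; exact: chart_atP.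
  - by move=> l; exact: Ck_cst.
  - move=> t a _ aa _.
    have lp : line_point p 0 t = p.
      by rewrite /line_point scaler0 add0r coordK//; exact: chart_atP.
    have := PO _ Pz; rewrite /line_frame/= lp /orthonormal_frames/=.
    rewrite chart_jacobian_id ?mul1mx; last exact: chart_atP.
    have -> : (z *m a)^T *m g p *m (z *m a) = a^T *m (z^T *m g p *m z) *m a.
      by rewrite trmx_mul !mulmxA.
    by move=> ->; rewrite mulmx1.
have tO : tangent (orthonormal_frames g) (p, z) (v, 'D_1 u 0).
  exact: tangent_sub PO tP.
have Oz : orthonormal_frames g (p, z) by exact: PO.
have omega_sub B C : C^T = - C -> tangent (orthonormal_frames g) (p, z) (v, B) ->
    omega (p, z) (v, B - z *m C) = omega (p, z) (v, B) - C.
  move=> skC tB.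
  have -> : (v, B - z *m C) = -1 *: ((0 : 'cV[R]_n), z *m C) + (v, B).
    by congr pair; rewrite /= ?scaler0 ?add0r// scaleN1r addrC.
  rewrite (cform_linear cform)//; last exact: vertical.
  by rewrite (cform_vertical cform (z := (p, z)))// scaleN1r addrC.
pose B := 'D_1 u 0 + z *m (- A).
have skNA : (- A)^T = - - A by rewrite linearN/= skA.
have tB : tangent P (p, z) (v, B).
  apply: (tangent_rotate oU U0 UD su skNA) => t a Ut aa af.
  apply: adapted => //; apply: af.
  by rewrite mulNmx mulmxN h_algebra_comm//; case: hA.
have [W WE] : exists W, W = omega (p, z) (v, 'D_1 u 0) - A by eexists.
have wB : omega (p, z) (v, B) = W.
  by rewrite /B mulmxN omega_sub// WE.
have obB : omegabar (p, z) (v, B) = 0.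
  by apply: (h_component_unique hA); have := hcomp _ _ Pz tB; rewrite wB WE.
have tBO : tangent (orthonormal_frames g) (p, z) (v, B) by exact: tangent_sub tB.
have skW : orthogonal_algebra W.
  by rewrite -wB; exact: (cform_valued cform).
exists omega, omegabar, z, B, W; split; [by []|split].
  split=> //.
  (* Rotating with generator - (A + W) keeps the frames orthonormal, though in general not adapted;
     orthonormality is all that is asked here. *)
  - have -> : B - z *m W = 'D_1 u 0 + z *m (- (A + W)).
      by rewrite /B opprD mulmxDr !mulmxN addrA.
    apply: (tangent_rotate oU U0 UD su) => [|t a Ut aa _].
      by rewrite linearN linearD/= skA skW -opprD.
    exact: rotated.
  - by rewrite omega_sub// wB subrr.
  - by move=> C hC; rewrite WE; have [_] := hA; exact.
(* The intertwining relation along the curve is differentiated at 0 for u'(0); it passes to B =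
   u'(0) - z A because A commutes with [f_matrix]. *)
have dFl : is_derive (0 : R^o) 1 Fl ('D_v (endo_rep c0 F \o param c0) (coord c0 p)).
  apply: (is_derive_lineP (endo_rep c0 F \o param c0) _ v _).1.
  apply: derivableP.
  apply: (@Ck_derivable _ _ _ 0 _ _ (sF c0 1%N)).
  by exists p => //; exact: chart_atP.
have du := derivableP (@Ck_derivable _ _ _ _ _ _ (su 1%N) 1 _ U0).
have [_ D1] := is_derive_mulmx dFl du.
have [_ D2] := is_derive_mulmx du (is_derive_cst f (0 : R^o) 1).
have Fz : F p *m z = z *m f.
  by have [_] := hu 0 U0; rewrite /Fl line_point0 endo_rep_at.
have : 'D_1 (fun t => Fl t *m u t) 0 = 'D_1 (fun t => u t *m f) 0.
  apply: near_eq_derive; apply: filterS (open_nbhs_nbhs (conj oU U0)) => t.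
  by move=> /hu[].
rewrite D1 D2 mulmx0 addr0 {1}/Fl line_point0 endo_rep_at -/z => D3.
rewrite /B mulmxDr mulmxDl addrA D3; congr (_ + _).
rewrite mulmxA Fz -!mulmxA; congr (_ *m _).
by rewrite mulmxN mulNmx h_algebra_comm//; case: hA.
Qed.

End Canonical.

(** * The difference of the two connections *)

Import Defs.

Section Parallel.
Context {R : realType} {k n2 : nat} {M : manifold R (k + (n2 + n2))}.
Notation n := (k + (n2 + n2))%N.
Variables (F : endo_field M) (g : bilinear_field M).
Variables (nabla nablabar : covariant_derivative M).
Hypothesis Fg : riemannian_f_structure F g (2 * n2).
Hypothesis canon : canonical_connection_f F g nabla nablabar.
Notation f := (@f_matrix R k n2).

(** At the frame z both derivatives equal the chart derivative of Y minus a matrix applied to Y at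
    p: B z^-1 for [nablabar], (B - z W) z^-1 for [nabla]. All five claims are read off these two
    expressions. *)
Lemma canonical_parallel (p : M) X : smooth_vf X ->
  exists H : 'M[R]_n,
  [/\ forall Y, smooth_vf Y -> nabla X Y p = nablabar X Y p + H *m Y p,
      forall Y, smooth_vf Y ->
        nablabar X (F \app Y) p = F p *m nablabar X Y p,
      forall a Y Y', smooth_vf Y -> smooth_vf Y' ->
        nablabar X (fun q => a *: Y q + Y' q) p =
        a *: nablabar X Y p + nablabar X Y' p,
      (F p *m F p + 1%:M) *m H *m (F p *m F p + 1%:M) = 0 &
      F p *m F p *m H *m (F p *m F p) = F p *m H *m F p].
Proof.
move=> sX; have sF : smooth_endo F by case: Fg => -[].
have [omega [omegabar [z [B [W [[cov covbar Pz skW] [[tB oB tW oW trW] DF]]]]]]] :=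
  horizontal_lift Fg canon p (X p).
have Oz : orthonormal_frames g (p, z) by case: Pz.
have uz : z \in unitmx by have /mulmx1_unit[] := Oz.
pose c := chart_at p; pose x := coord c p.
pose D Y := 'D_(X p) (vector_rep c Y \o param c) x.
have barE Y : smooth_vf Y -> nablabar X Y p = D Y - B *m invmx z *m Y p.
  by move=> sY; have := covariant_derivativeE covbar sX sY Pz tB oB erefl uz.
have nabE Y : smooth_vf Y ->
    nabla X Y p = D Y - (B - z *m W) *m invmx z *m Y p.
  by move=> sY; have := covariant_derivativeE cov sX sY Oz tW oW erefl uz.
have Ux : (coord c @` dom c) x by exists p => //; exact: chart_atP.
have oU : open (coord c @` dom c) by exact: coord_open.
have dY Y : smooth_vf Y -> is_derive x (X p) (vector_rep c Y \o param c) (D Y).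
  move=> sY; apply: derivableP.
  exact: (@Ck_derivable _ _ _ _ _ _ (sY c 1%N)).
have Fz : F p *m z = z *m f by case: Pz.
have zF : f *m invmx z = invmx z *m F p.
  by apply: (can_inj (mulKmx uz)); rewrite mulmxA -Fz mulmxK// mulKVmx.
(* The frame intertwines [f_matrix] with [F p], so the two block conditions on W pass to its
   conjugate H. *)
have frameJ (A : 'M[R]_n) a : A *m z = z *m a -> a *m invmx z = invmx z *m A ->
    A *m (z *m W *m invmx z) *m A = z *m (a *m W *m a) *m invmx z.
  by move=> Az zA; rewrite !mulmxA Az -[LHS]mulmxA -zA !mulmxA.
have FFz : F p *m F p *m z = z *m (f *m f).
  by rewrite -mulmxA Fz mulmxA Fz mulmxA.
have zFF : f *m f *m invmx z = invmx z *m (F p *m F p).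
  by rewrite -mulmxA zF mulmxA zF mulmxA.
have [W1 W2] := h_orthogonalP skW trW.
exists (z *m W *m invmx z); split.
- move=> Y sY; rewrite nabE// barE// !mulmxBl opprB addrA addrAC.
  by rewrite -addrA.
- move=> Y sY; rewrite barE; last exact: smooth_app.
  have sFD : is_derive x (X p) (endo_rep c F \o param c)
      ('D_(X p) (endo_rep c F \o param c) x).
    by apply: derivableP; exact: (@Ck_derivable _ _ _ _ _ _ (sF c 1%N)).
  have -> : D (F \app Y) =
      'D_(X p) (endo_rep c F \o param c) x *m Y p + F p *m D Y.
    have [_] := is_derive_mulmx sFD (dY Y sY).
    rewrite /= /x coordK; last exact: chart_atP.
    rewrite endo_rep_at vector_rep_at => <-.
    apply: near_eq_derive; apply: filterS (open_nbhs_nbhs (conj oU Ux)).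
    by move=> _ [q cq <-] /=; rewrite coordK// vector_rep_app.
  (* The differentiated relation F z = z [f_matrix], multiplied by z^-1; it cancels the derivative
     of F in the product rule. *)
  have DFB : B *m invmx z *m F p =
      'D_(X p) (endo_rep c F \o param c) x + F p *m B *m invmx z.
    by rewrite -mulmxA -zF mulmxA -DF mulmxDl mulmxK.
  rewrite barE// /tensor_app mulmxBr mulmxA DFB mulmxDl !mulmxA opprD addrACA.
  by rewrite subrr add0r.
- move=> a Y Y' sY sY'.
  have DaY := is_deriveD (is_deriveZ a (dY Y sY)) (dY Y' sY').
  have repE : vector_rep c (fun q => a *: Y q + Y' q) \o param c =
      a \*: (vector_rep c Y \o param c) + (vector_rep c Y' \o param c).
    by apply/funext => y; rewrite /vector_rep /= mulmxDr -scalemxAr.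
  have sYY : smooth_vf (fun q => a *: Y q + Y' q).
    apply/smooth_repP => l d; rewrite (_ : _ \o _ = fun y =>
      a *: (vector_rep d Y \o param d) y + (vector_rep d Y' \o param d) y).
      apply: Ck_add; [exact: coord_open| |exact: sY'].
      by apply: Ck_scale; [exact: coord_open|exact: Ck_cst|exact: sY].
    by apply/funext => y; rewrite /vector_rep /= mulmxDr -scalemxAr.
  rewrite !barE// {1}/D repE; have [_ ->] := DaY.
  rewrite mulmxDr -scalemxAr scalerBr opprD addrACA.
  by [].
- rewrite (frameJ _ (f *m f + 1%:M)) ?W1 ?mulmx0 ?mul0mx//.
    by rewrite mulmxDl mulmxDr FFz mul1mx mulmx1.
  by rewrite mulmxDl mulmxDr zFF mul1mx mulmx1.
- by rewrite (frameJ _ _ FFz zFF) W2 (frameJ _ _ Fz zF).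
Qed.

End Parallel.

(** * Block identities for H relative to L and V *)

Section FinalAlgebra.
Context {R : realType} {n : nat}.
Variables (F H : 'M[R]_n).
Hypothesis F3 : F *m F *m F + F = 0.
Notation P1 := (F *m F + 1%:M).
Notation P2 := (- (F *m F)).
Hypothesis H11 : P1 *m H *m P1 = 0.
Hypothesis H22 : F *m F *m H *m (F *m F) = F *m H *m F.

Lemma mul_P2_H_P2 : P2 *m H *m P2 = F *m H *m F.
Proof. by rewrite !mulNmx mulmxN opprK. Qed.

Lemma H_decomposition : H = P1 *m H *m P2 + P2 *m H *m P1 + F *m H *m F.
Proof.
rewrite -mul_P2_H_P2 -addrA -mulmxDr P1_add_P2 mulmx1.
rewrite -[P1 *m H *m P2]add0r -H11 -mulmxDr P1_add_P2 mulmx1 -mulmxDl.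
by rewrite P1_add_P2 mul1mx.
Qed.

(** Here b stands for [nablabar X Y p] and y for [Y p]; for a tensor A parallel under the canonical
    connection, the Riemannian derivative of A Y is A b + H A y. The L-block of H is zero, and the
    two V-terms F H F y cancel, while b is recovered from its projections. *)
Lemma projected_derivative (b y : 'cV[R]_n) :
  b = P1 *m (P1 *m b + H *m (P1 *m y)) +
      2^-1 *: (P2 *m (P2 *m b + H *m (P2 *m y) - F *m (F *m b + H *m (F *m y)))).
Proof.
have eb : b = P1 *m b + P2 *m b by rewrite -mulmxDl P1_add_P2 mul1mx.
have FF : F *m F = - P2 by rewrite opprK.
have p11 := mul_P1_P1 F3; have p22 := mul_P2_P2 F3; have p2F := mul_P2_F F3.
have h22 := mul_P2_H_P2.
(* The projections are made opaque; once the products are rewritten, the identity is linear in the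
   entries. *)
move: P1 P2 H11 h22 eb p11 p22 p2F FF => p1 p2 h11 h22 eb p11 p22 p2F FF.
rewrite !(mulmxDr, mulmxN) !mulmxA h11 h22 p11 p22 p2F FF mul0mx mulNmx {1}eb.
by apply/colP => i; rewrite !mxE; lra.
Qed.

(** The plus sign reverses the roles: now the b-terms cancel, and the two copies of F H F y, halved,
    complete the off-diagonal blocks to H y. *)
Lemma projected_shift (b y : 'cV[R]_n) :
  H *m y = P1 *m (P2 *m b + H *m (P2 *m y)) + P2 *m (P1 *m b + H *m (P1 *m y)) +
      2^-1 *: (P2 *m (P2 *m b + H *m (P2 *m y) + F *m (F *m b + H *m (F *m y)))).
Proof.
have FF : F *m F = - P2 by rewrite opprK.
have p12 := mul_P1_P2 F3; have p21 := mul_P2_P1 F3.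
have p22 := mul_P2_P2 F3; have p2F := mul_P2_F F3.
have h22 := mul_P2_H_P2; have Hdec := H_decomposition.
move: P1 P2 Hdec h22 p12 p21 p22 p2F FF => p1 p2 Hdec h22 p12 p21 p22 p2F FF.
rewrite !mulmxDr !mulmxA h22 p12 p21 p22 p2F FF !mul0mx mulNmx.
rewrite {1}Hdec !mulmxDl.
by apply/colP => i; rewrite !mxE; lra.
Qed.

Variable e : R.
Hypothesis ee : e * e = 1.
Notation S := (F + e *: P1).

Lemma mul_S_S : S *m S = P1 - P2.
Proof.
rewrite mulmxDl !mulmxDr -!scalemxAl -!scalemxAr mul_F_P1// mul_P1_F//.
by rewrite mul_P1_P1// scalerA ee scale1r !scaler0 addr0 add0r opprK addrC.
Qed.

Lemma mul_S_S_S : S *m (S *m S) = e *: P1 - F.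
Proof.
rewrite mul_S_S mulmxDl !mulmxBr -!scalemxAl mul_F_P1// mul_F_P2//.
by rewrite mul_P1_P1// mul_P1_P2// scaler0 subr0 sub0r addrC.
Qed.

Lemma mul_S4 : S *m S *m (S *m S) = 1%:M.
Proof.
rewrite mul_S_S mulmxBl !mulmxBr mul_P1_P1// mul_P1_P2// mul_P2_P1// mul_P2_P2//.
by rewrite subr0 sub0r opprK P1_add_P2.
Qed.

(** As S^3 = S^-1, this is the sum of the conjugates of H under the cyclic group generated by S. The
    mixed blocks cancel because 1, F, F^2, F^3 sum to zero on V, also with alternating signs; on the
    V-block conjugation by F is multiplication by -1. *)
Lemma S_average : H + S *m H *m (S *m (S *m S)) + S *m S *m H *m (S *m S)
  + S *m (S *m S) *m H *m S = 0.
Proof.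
rewrite mul_S_S_S mul_S_S; have Hdec := H_decomposition; have H22' := mul_P2_H_P2.
move: P1 P2 H11 H22' Hdec => p1 p2 h11 h22 Hdec.
rewrite !(mulmxDl, mulmxBl) !(mulmxDr, mulmxBr) !(mulmxN, mulNmx).
rewrite -!scalemxAl -!scalemxAr h11 h22 {1}Hdec !scaler0.
apply/matrixP => i j; rewrite !mxE; ring.
Qed.

(** Each summand is S^i (S^-i b + H S^-i y) = b + S^i H S^-i y; four copies of b remain, and the
    H-terms sum to zero. *)
Lemma averaged_derivative (b y : 'cV[R]_n) :
  b = 4^-1 *: (b + H *m y
    + S *m (S *m (S *m (S *m b)) + H *m (S *m (S *m (S *m y))))
    + S *m (S *m (S *m (S *m b) + H *m (S *m (S *m y))))
    + S *m (S *m (S *m (S *m b + H *m (S *m y))))).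
Proof.
have S4 := mul_S4; have := congr1 (mulmx^~ y) S_average.
move: S S4 => s s4; rewrite mul0mx !mulmxDl -!mulmxA => Hy.
have s4b : s *m (s *m (s *m (s *m b))) = b.
  by rewrite -[RHS]mul1mx -s4 -!mulmxA.
rewrite !mulmxDr s4b; apply/colP => i; move/colP/(_ i): Hy; rewrite !mxE.
lra.
Qed.

End FinalAlgebra.

(** * The three formulas *)

Import Defs.

Lemma eq_mulmx_vec (R : realType) m n (A B : 'M[R]_(m, n)) :
  (forall v : 'cV[R]_n, A *m v = B *m v) -> A = B.
Proof.
move=> AB; apply/matrixP => i j; have := AB (delta_mx j ord0).
by rewrite -!colE => /colP/(_ i); rewrite !mxE.
Qed.

(** L and V span, so S is a polynomial in F; this is how it inherits smoothness and parallelism. *)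
Lemma s_tensorE (R : realType) n (M : manifold R n) (F S : endo_field M) eps p :
  F p *m F p *m F p + F p = 0 -> s_tensor eps F S ->
  S p = F p + eps *: pi1 F p.
Proof.
move=> F3 /(_ p)[SV SL].
have S2 : S p *m pi2 F p = F p.
  rewrite -[RHS](mul_F_P2 F3); apply: eq_mulmx_vec => v.
  by rewrite -!mulmxA SV//; exists v.
have S1 : S p *m pi1 F p = eps *: pi1 F p.
  apply: eq_mulmx_vec => v; rewrite -mulmxA SL ?scalemxAl//; exists v => //.
by rewrite -[LHS]mulmx1 -(P1_add_P2 (F p)) mulmxDr S1 S2 addrC.
Qed.

Theorem theorem5p33 (R : realType) (k n2 : nat)
    (M : manifold R (k + (n2 + n2))) (F : endo_field M) (g : bilinear_field M)
    (nabla nablabar : covariant_derivative M) :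
  riemannian_f_structure F g (2 * n2) ->
  riemannian_connection g nabla ->
  canonical_connection_f F g nabla nablabar ->
  forall X Y : vector_field M, smooth_vf X -> smooth_vf Y ->
  [/\ forall p,
        nablabar X Y p =
          (pi1 F \app nabla X (pi1 F \app Y)) p
          + 2^-1 *: (pi2 F p *m (nabla X (pi2 F \app Y) p
                       - (F \app nabla X (F \app pi2 F \app Y)) p)),
      forall p,
        second_fundamental nabla nablabar X Y p =
          (pi1 F \app nabla X (pi2 F \app Y)) p
          + (pi2 F \app nabla X (pi1 F \app Y)) p
          + 2^-1 *: (pi2 F p *m (nabla X (pi2 F \app Y) p
                       + (F \app nabla X (F \app pi2 F \app Y)) p)) &
      forall (eps : R) (S : endo_field M), eps = 1 \/ eps = -1 ->
        s_tensor eps F S -> forall p,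
        nablabar X Y p =
          4^-1 *: (nabla X Y p
                   + (S \app nabla X (S \app S \app S \app Y)) p
                   + (S \app S \app nabla X (S \app S \app Y)) p
                   + (S \app S \app S \app nabla X (S \app Y)) p)].
Proof.
move=> Fg _ canon X Y sX sY.
have sF : smooth_endo F by case: Fg => -[].
have F3 p := f_structure3 Fg p.
(* The matrix H depends on p, so the formulas are proved one point at a time. *)
suff at_point p : [/\ nablabar X Y p =
          (pi1 F \app nabla X (pi1 F \app Y)) p
          + 2^-1 *: (pi2 F p *m (nabla X (pi2 F \app Y) p
                       - (F \app nabla X (F \app pi2 F \app Y)) p)),
        second_fundamental nabla nablabar X Y p =
          (pi1 F \app nabla X (pi2 F \app Y)) p
          + (pi2 F \app nabla X (pi1 F \app Y)) p
          + 2^-1 *: (pi2 F p *m (nabla X (pi2 F \app Y) p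
                       + (F \app nabla X (F \app pi2 F \app Y)) p)) &
      forall (eps : R) (S : endo_field M), eps = 1 \/ eps = -1 ->
        s_tensor eps F S ->
        nablabar X Y p =
          4^-1 *: (nabla X Y p
                   + (S \app nabla X (S \app S \app S \app Y)) p
                   + (S \app S \app nabla X (S \app S \app Y)) p
                   + (S \app S \app S \app nabla X (S \app Y)) p)].
  split=> [p|p|eps S epsE SE p]; have [h1 h2 h3] := at_point p => //.
  exact: (h3 eps S).
have [H [nabE barF barL H11 H22]] := canonical_parallel Fg canon p sX.
(* Such tensors are closed under linear combinations and products, so [pi1 F], [pi2 F] and S inherit
   the property from F. Smoothness is carried along so that A Z is again an admissible vector
   field. *)
pose parallel A := smooth_endo A /\
  forall Z, smooth_vf Z -> nablabar X (A \app Z) p = A p *m nablabar X Z p.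
have parF : parallel F by [].
have par_comb a A A' : parallel A -> parallel A' ->
    parallel (fun q => a *: A q + A' q).
  move=> [sA pA] [sA' pA']; split=> [|Z sZ].
    by apply: smooth_endo_add => //; exact: smooth_endo_scale.
  rewrite (_ : _ \app Z = fun q => a *: (A \app Z) q + (A' \app Z) q).
    rewrite barL; [|exact: smooth_app..].
    by rewrite pA// pA'// mulmxDl scalemxAl.
  by apply/funext => q; rewrite /tensor_app mulmxDl scalemxAl.
have par_id : parallel (fun=> 1%:M).
  split=> [|Z sZ]; first exact: smooth_endo_one.
  rewrite mul1mx; congr nablabar; apply/funext => q; exact: mul1mx.
have par_mul A A' : parallel A -> parallel A' -> parallel (fun q => A q *m A' q).
  move=> [sA pA] [sA' pA']; split=> [|Z sZ]; first exact: smooth_endo_mul.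
  rewrite (_ : _ \app Z = A \app A' \app Z).
    by rewrite pA ?pA' ?mulmxA//; exact: smooth_app.
  by apply/funext => q; rewrite /tensor_app mulmxA.
have par1 : parallel (pi1 F).
  rewrite (_ : pi1 F = fun q => 1 *: (F q *m F q) + 1%:M).
    by apply: (par_comb 1 (fun q => F q *m F q)) => //; exact: par_mul.
  by apply/funext => q; rewrite scale1r.
have par2 : parallel (pi2 F).
  rewrite (_ : pi2 F = fun q => -1 *: pi1 F q + 1%:M).
    exact: par_comb.
  by apply/funext => q; rewrite scaleN1r /pi1 /pi2 opprD addrNK.
(* This turns every Riemannian derivative in the three formulas into b and H, and leaves the matrix
   identities proved above. *)
have nab A Z : parallel A -> smooth_vf Z -> nabla X (A \app Z) p =
    A p *m nablabar X Z p + H *m (A p *m Z p).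
  by move=> [sA pA] sZ; rewrite nabE ?pA//; exact: smooth_app.
have F3p := F3 p.
have H2 := mul_P2_H_P2 H22; have Hdec := H_decomposition H11 H22.
set b := nablabar X Y p.
have nab1 := nab _ _ par1 sY; have nab2 := nab _ _ par2 sY.
have nabF2 : nabla X (F \app pi2 F \app Y) p =
    F p *m b + H *m (F p *m Y p).
  rewrite nab//; last exact: smooth_app par2.1 sY.
  by rewrite par2.2// /tensor_app !(mulmxA (F p)) [F p *m pi2 F p]mul_F_P2.
split.
- by rewrite /tensor_app nab1 nab2 nabF2; exact: projected_derivative.
- rewrite /second_fundamental nabE// addrAC subrr add0r.
  by rewrite /tensor_app nab1 nab2 nabF2; exact: projected_shift.
- move=> eps S epsE /s_tensorE SE.
  have SE' : S = fun q => eps *: pi1 F q + F q.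
    by apply/funext => q; rewrite SE// addrC.
  have ee : eps * eps = 1 by case: epsE => ->; rewrite ?mulrNN mulr1.
  have parS : parallel S by rewrite SE'; exact: par_comb.
  have sSY := smooth_app parS.1 sY; have sSSY := smooth_app parS.1 sSY.
  have := averaged_derivative F3p H11 H22 ee b (Y p); rewrite -SE//.
  rewrite /tensor_app nabE// -/b.
  rewrite (nab _ (S \app S \app Y))// (nab _ (S \app Y))// (nab _ Y)//.
  by rewrite (parS.2 (S \app Y))// !parS.2.
Qed.
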